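(* Consider the following six types of directed graphs: (i) dominated directed rays; (ii) $\mathcal{D}(S)$ for a subdivided star $S$; (iii) directed graphs shaped by a star whose centre is a dominated directed ray; (iv) $\mathcal{D}(C)$ for a comb $C$; (v) directed graphs shaped by a comb with directed triangles at the junctions; (vi) chains of triangles. For each of these six types $\tau$ there exist a strongly connected directed graph $D$ and an infinite set $U\subseteq V(D)$ such that no butterfly minor of $D$ that has all its teeth in $U$ is of one of the five types other than $\tau$. (That is, none of the six types can be omitted from the list in the statement: ''for every infinite set $U$ of vertices of a strongly connected directed graph $D$ there is a butterfly minor of $D$ that is of one of the types (i)--(vi) and has all teeth in $U$''.)
   Context: Paths may be trivial (a single vertex) unless stated otherwise. A directed graph is strongly connected if for all vertices $u,v$ it contains a directed $u$--$v$ path. **Undirected notions.** A star is a graph $K_{1,\infty}$ (one centre, countably infinitely many leaves); the teeth of a (subdivided) star are its leaves. A ray is a one-way infinite path. A comb is the union of a ray $R$ with infinitely many disjoint (possibly trivial) finite paths having precisely their first vertex on $R$; the last vertices of these paths are its teeth. A vertex $v$ of a comb is a junction if $v$ has degree $3$, or $v$ is a tooth and has degree $2$. For a graph $G$, $\mathcal{D}(G)$ is obtained from $G$ by replacing each edge $uv$ by the directed edges $(u,v),(v,u)$; a double path is $\mathcal{D}(P)$ for a finite path $P$. **Arborescences and rays.** An in-arborescence (out-arborescence) is a directed graph whose underlying undirected graph is a rooted tree, with all edges directed towards (away from) the root. An in-ray (out-ray) is an in-arborescence (out-arborescence) whose underlying undirected graph is a ray rooted at its unique vertex of degree $1$. **Type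 (i).** A dominated directed ray is either the union of an out-ray $R$ with root $r$ and edges $(v,r)$ (tail $v$, head $r$) for all $v\in V(R)\setminus\{r\}$, or the union of an in-ray $R$ with root $r$ and edges $(r,v)$ for all $v\in V(R)\setminus\{r\}$. All its vertices are called teeth. **Types (ii), (iii).** Let $S$ be a subdivided star. Type (ii) is $\mathcal{D}(S)$. Type (iii) is a directed graph obtained from $\mathcal{D}(S)$ by replacing the unique vertex $w$ of infinite degree by a dominated directed ray with vertex set $\{w_n : n\in N_S(w)\}$ (the $w_n$ distinct) such that for every $n\in N_S(w)$ the edges $(w,n),(n,w)$ become $(w_n,n),(n,w_n)$. In both cases the teeth are the vertices corresponding to the leaves of $S$. **Types (iv), (v).** Let $C$ be a comb. Type (iv) is $\mathcal{D}(C)$. Type (v) is a directed graph obtained from $\mathcal{D}(C)$ by replacing each junction $j$ of $C$ by a directed cycle of length $3$ such that: if $d_C(j)=3$, the three strong components of $\mathcal{D}(C)-j$ become incident with distinct vertices of this directed cycle (the two edges between $j$ and a given component become incident with the same cycle vertex); otherwise the tooth $j$ is a vertex of this directed cycle and the two strong components of $\mathcal{D}(C)-j$ become incident with the two distinct other vertices of the cycle. In both cases the teeth are the vertices corresponding to the teeth of $C$. **Type (vi).** A chain of triangles is the union of the directed graph with vertex set $\bigcup_{i\in\mathbb{N}}\{a_i,b_i,c_i\}$ (all distinct) and edge set $\{(a_i,b_i),(b_i,c_i),(c_i,a_i),(a_{i+1},a_i),(c_i,c_{i+1}): i\in\mathbb{N}\}$ with disjoint (possibly trivial) double paths $F_i$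 with endpoints $b_i$ and $y_i$, $i\in\mathbb{N}$, each meeting $\bigcup_i\{a_i,b_i,c_i\}$ only in $b_i$. Its teeth are the vertices $y_i$. **Butterfly minor.** A tree-like model of a directed graph $H$ in a directed graph $D$ is a map $\mu$ assigning to every edge of $H$ an edge of $D$ and to every vertex of $H$ a subgraph of $D$ such that: $\mu(v)\cap\mu(w)=\emptyset$ for all distinct $v,w\in V(H)$; for every $v\in V(H)$, $\mu(v)$ is the union of an in-arborescence $T_{\mathrm{in}}^{\mu(v)}$ and an out-arborescence $T_{\mathrm{out}}^{\mu(v)}$ which have only their roots in common; for every $e=(u,v)\in E(H)$, the edge $\mu(e)$ has its tail in $T_{\mathrm{out}}^{\mu(u)}$ and its head in $T_{\mathrm{in}}^{\mu(v)}$. $H$ is a butterfly minor of $D$ if there is a tree-like model of $H$ in $D$. Each vertex $v$ of $H$ is identified with the common root of $T_{\mathrm{in}}^{\mu(v)}$ and $T_{\mathrm{out}}^{\mu(v)}$; so ''$v\in U$'' means that this common root lies in $U$. *)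

(* Defs.v *)
From mathcomp Require Import all_boot.
From mathcomp Require Import boolp classical_sets functions cardinality.

Set Implicit Arguments.
Unset Strict Implicit.
Unset Printing Implicit Defensive.

Local Open Scope classical_set_scope.
#[local] Obligation Tactic := idtac.

(* Graphs live inside an ambient type, so that subgraphs and unions can be
   taken literally; the ambient type may be larger than the vertex set. *)

Record ugraph (V : Type) := UGraph {
  uvert : set V;
  uedge : V -> V -> Prop;
  uedge_irr : forall x, ~ uedge x x;
  uedge_sym : forall x y, uedge x y -> uedge y x;
  uedge_vert : forall x y, uedge x y -> uvert x }.

Record digraph (V : Type) := DiGraph {
  dvert : set V;
  dedge : V -> V -> Prop;  (* [dedge x y]: edge with tail [x] and head [y] *)
  dedge_irr : forall x, ~ dedge x x;
  dedge_vert : forall x y, dedge x y -> dvert x /\ dvert y }.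

Definition ugraph_eq V (G H : ugraph V) : Prop :=
  uvert G = uvert H /\ forall x y, uedge G x y <-> uedge H x y.

Definition digraph_eq V (D E : digraph V) : Prop :=
  dvert D = dvert E /\ forall x y, dedge D x y <-> dedge E x y.

Definition subdigraph V (D E : digraph V) : Prop :=
  dvert D `<=` dvert E /\ forall x y, dedge D x y -> dedge E x y.

Program Definition uunion V (G H : ugraph V) : ugraph V :=
  @UGraph V (uvert G `|` uvert H) (fun x y => uedge G x y \/ uedge H x y)
    _ _ _.
Next Obligation. by move=> V G H x [e|e]; exact: uedge_irr e. Qed.
Next Obligation.
by move=> V G H x y [e|e]; [left|right]; exact: uedge_sym.
Qed.
Next Obligation. by move=> V G H x y [e|e]; [left|right]; exact: uedge_vert e. Qed.

Program Definition ubigunion V (G : nat -> ugraph V) : ugraph V :=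
  @UGraph V (\bigcup_i uvert (G i)) (fun x y => exists i, uedge (G i) x y)
    _ _ _.
Next Obligation. by move=> V G x [i e]; exact: uedge_irr e. Qed.
Next Obligation. by move=> V G x y [i e]; exists i; exact: uedge_sym. Qed.
Next Obligation. by move=> V G x y [i e]; exists i => //; exact: uedge_vert e. Qed.

Program Definition dunion V (D E : digraph V) : digraph V :=
  @DiGraph V (dvert D `|` dvert E) (fun x y => dedge D x y \/ dedge E x y)
    _ _.
Next Obligation. by move=> V D E x [e|e]; exact: dedge_irr e. Qed.
Next Obligation.
by move=> V D E x y [e|e]; have [hx hy] := dedge_vert e; split;
  [left|left|right|right].
Qed.

Program Definition doubling V (G : ugraph V) : digraph V :=
  @DiGraph V (uvert G) (uedge G) _ _.
Next Obligation. by move=> V G x e; exact: uedge_irr e. Qed.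
Next Obligation.
by move=> V G x y e; split; [exact: uedge_vert e | exact: uedge_vert (uedge_sym e)].
Qed.

Program Definition underlying V (D : digraph V) : ugraph V :=
  @UGraph V (dvert D) (fun x y => dedge D x y \/ dedge D y x) _ _ _.
Next Obligation. by move=> V D x [e|e]; exact: dedge_irr e. Qed.
Next Obligation. by move=> V D x y []; [right|left]. Qed.
Next Obligation. by move=> V D x y [e|e]; have [hx hy] := dedge_vert e. Qed.

Program Definition delete_vertex V (D : digraph V) (v : V) : digraph V :=
  @DiGraph V (dvert D `\ v) (fun x y => [/\ dedge D x y, x <> v & y <> v])
    _ _.
Next Obligation. by move=> V D v x [e _ _]; exact: dedge_irr e. Qed.
Next Obligation. by move=> V D v x y [e xv yv]; have [hx hy] := dedge_vert e. Qed.

(* [p 0, ..., p n] is a path (directed if [E] is not symmetric); only these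
   values of [p] matter. *)
Definition is_path V (E : V -> V -> Prop) (n : nat) (p : nat -> V) : Prop :=
  (forall i, i < n -> E (p i) (p i.+1)) /\
  (forall i j, i <= n -> j <= n -> p i = p j -> i = j).

Definition reachable V (E : V -> V -> Prop) (x y : V) : Prop :=
  exists n p, [/\ is_path E n p, p 0 = x & p n = y].

Definition on_path_between V (E : V -> V -> Prop) (x y z : V) : Prop :=
  exists n p, [/\ is_path E n p, p 0 = x, p n = z &
    exists2 i, i <= n & p i = y].

Definition strongly_connected V (D : digraph V) : Prop :=
  forall x y, dvert D x -> dvert D y -> reachable (dedge D) x y.

Definition same_strong_component V (D : digraph V) (x y : V) : Prop :=
  [/\ dvert D x, dvert D y, reachable (dedge D) x y &
      reachable (dedge D) y x].

Definition is_cycle V (E : V -> V -> Prop) (n : nat) (c : nat -> V) : Prop :=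
  [/\ 3 <= n, (forall i, i < n -> E (c i) (c (i.+1 %% n))) &
      (forall i j, i < n -> j < n -> c i = c j -> i = j)].

Definition is_tree V (G : ugraph V) : Prop :=
  [/\ uvert G !=set0,
      (forall x y, uvert G x -> uvert G y -> reachable (uedge G) x y) &
      forall n c, ~ is_cycle (uedge G) n c].

Definition is_path_graph V (P : ugraph V) (n : nat) (p : nat -> V) : Prop :=
  [/\ (forall i j, i <= n -> j <= n -> p i = p j -> i = j),
      uvert P = [set p i | i in `I_n.+1] &
      forall x y, uedge P x y <-> exists2 i, i < n &
        (x = p i /\ y = p i.+1) \/ (x = p i.+1 /\ y = p i)].

Definition is_ray V (R : ugraph V) (r : nat -> V) : Prop :=
  [/\ injective r, uvert R = range r &
      forall x y, uedge R x y <-> exists i,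
        (x = r i /\ y = r i.+1) \/ (x = r i.+1 /\ y = r i)].

(* [w] is the centre and [T] the set of leaves; the [n]-th edge of the star is
   subdivided into the path [P n]. *)
Definition is_subdivided_star V (S : ugraph V) (w : V) (T : set V) : Prop :=
  exists (P : nat -> ugraph V) (l : nat -> nat) (p : nat -> nat -> V),
  [/\ (forall n, [/\ 0 < l n, is_path_graph (P n) (l n) (p n) & p n 0 = w]),
      (forall m n, m <> n -> uvert (P m) `&` uvert (P n) = [set w]),
      ugraph_eq S (ubigunion P) &
      T = range (fun n => p n (l n))].

Definition is_comb V (C : ugraph V) (T : set V) : Prop :=
  exists (R : ugraph V) (r : nat -> V)
    (P : nat -> ugraph V) (l : nat -> nat) (p : nat -> nat -> V),
  [/\ is_ray R r,
      (forall n, is_path_graph (P n) (l n) (p n) /\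
                 uvert (P n) `&` uvert R = [set p n 0]),
      (forall m n, m <> n -> uvert (P m) `&` uvert (P n) = set0),
      ugraph_eq C (uunion R (ubigunion P)) &
      T = range (fun n => p n (l n))].

Definition has_degree V (G : ugraph V) (v : V) (d : nat) : Prop :=
  ([set x | uedge G v x] #= `I_d)%card.

Definition junction V (C : ugraph V) (T : set V) : set V :=
  [set v | uvert C v /\ (has_degree C v 3 \/ (T v /\ has_degree C v 2))].

Definition is_in_arborescence V (A : digraph V) (r : V) : Prop :=
  [/\ is_tree (underlying A), dvert A r &
      forall x y, dedge A x y ->
        on_path_between (uedge (underlying A)) x y r].

Definition is_out_arborescence V (A : digraph V) (r : V) : Prop :=
  [/\ is_tree (underlying A), dvert A r &
      forall x y, dedge A x y ->
        on_path_between (uedge (underlying A)) r x y].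

Definition is_in_ray V (R : digraph V) (r : V) : Prop :=
  is_in_arborescence R r /\
  exists2 p, is_ray (underlying R) p & p 0 = r.

Definition is_out_ray V (R : digraph V) (r : V) : Prop :=
  is_out_arborescence R r /\
  exists2 p, is_ray (underlying R) p & p 0 = r.

Definition is_dominated_ray V (H : digraph V) : Prop :=
  exists (R : digraph V) (r : V), dvert H = dvert R /\
  ((is_out_ray R r /\
    forall x y, dedge H x y <->
      dedge R x y \/ [/\ dvert R x, x <> r & y = r]) \/
   (is_in_ray R r /\
    forall x y, dedge H x y <->
      dedge R x y \/ [/\ x = r, dvert R y & y <> r])).

Definition is_directed_triangle V (K : digraph V) : Prop :=
  exists x y z : V,
  [/\ [/\ x <> y, y <> z & z <> x],
      dvert K = [set x; y; z] &
      forall u v, dedge K u v <->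
        [\/ u = x /\ v = y, u = y /\ v = z | u = z /\ v = x]].

(* The six types: [T] is the set of teeth of [H]. *)

Definition dominated_directed_ray V (H : digraph V) (T : set V) : Prop :=
  is_dominated_ray H /\ T = dvert H.

Definition double_star V (H : digraph V) (T : set V) : Prop :=
  exists (S : ugraph V) (w : V),
    is_subdivided_star S w T /\ digraph_eq H (doubling S).

(* The replacement of [w] takes place inside the ambient type of [H]: the new
   vertices [f n] only have to avoid the surviving vertices of [S], so [w] itself
   may be one of them and every [H] of the intended shape is covered. *)
Definition star_of_dominated_ray V (H : digraph V) (T : set V) : Prop :=
  exists (S : ugraph V) (w : V) (Q : digraph V) (f : V -> V),
  let N := [set n | uedge S w n] in
  [/\ is_subdivided_star S w T,
      [/\ is_dominated_ray Q,
          (forall m n, N m -> N n -> f m = f n -> m = n),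
          dvert Q = f @` N &
          dvert Q `&` (uvert S `\ w) = set0],
      dvert H = (uvert S `\ w) `|` dvert Q &
      forall x y, dedge H x y <->
        [\/ dedge Q x y,
            [/\ uedge S x y, x <> w & y <> w] |
            exists2 n, N n & (x = f n /\ y = n) \/ (x = n /\ y = f n)]].

Definition double_comb V (H : digraph V) (T : set V) : Prop :=
  exists C : ugraph V, is_comb C T /\ digraph_eq H (doubling C).

(* As above, the triangle [K j] replacing the junction [j] may contain [j].
   [att u v] is the vertex of [H] that takes the place of the end [u] of the
   edge [uv] of [C]: it is [u] itself unless [u] is a junction. *)
Definition comb_of_triangles V (H : digraph V) (T : set V) : Prop :=
  exists (C : ugraph V) (K : V -> digraph V) (att : V -> V -> V),
  let J := junction C T in
  [/\ is_comb C T,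
      [/\ (forall j, J j -> is_directed_triangle (K j)),
          (forall j, J j -> dvert (K j) `&` (uvert C `\` J) = set0) &
          (forall i j, J i -> J j -> i <> j ->
             dvert (K i) `&` dvert (K j) = set0)],
      [/\ (forall u v, uedge C u v -> ~ J u -> att u v = u),
          (forall j n, J j -> uedge C j n -> dvert (K j) (att j n)),
          (forall j m n, J j -> uedge C j m -> uedge C j n ->
             (att j m = att j n <->
              same_strong_component (delete_vertex (doubling C) j) m n)) &
          (forall j, J j -> ~ has_degree C j 3 ->
             dvert (K j) j /\ forall n, uedge C j n -> att j n <> j)],
      dvert H = (uvert C `\` J) `|` \bigcup_(j in J) dvert (K j) &
      forall x y, dedge H x y <->
        (exists2 j, J j & dedge (K j) x y) \/
        (exists u v, [/\ uedge C u v, x = att u v & y = att v u])].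

Definition chain_of_triangles V (H : digraph V) (T : set V) : Prop :=
  exists (a b c : nat -> V)
    (P : nat -> ugraph V) (l : nat -> nat) (p : nat -> nat -> V),
  let A := range a `|` range b `|` range c in
  [/\ [/\ injective a, injective b & injective c] /\
      (forall i j, [/\ a i <> b j, b i <> c j & c i <> a j]),
      [/\ (forall i, is_path_graph (P i) (l i) (p i) /\ p i 0 = b i),
          (forall i, uvert (P i) `&` A = [set b i]) &
          (forall i j, i <> j -> uvert (P i) `&` uvert (P j) = set0)],
      dvert H = A `|` \bigcup_i uvert (P i),
      (forall x y, dedge H x y <->
        exists i,
          [\/ x = a i /\ y = b i, x = b i /\ y = c i | x = c i /\ y = a i] \/
          [\/ x = a i.+1 /\ y = a i, x = c i /\ y = c i.+1 |
              dedge (doubling (P i)) x y]) &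
      T = range (fun i => p i (l i))].

Inductive digraph_type :=
  | DominatedRay | DoubleStar | StarOfDominatedRay
  | DoubleComb | CombOfTriangles | ChainOfTriangles.

Definition is_of_type (tau : digraph_type) V (H : digraph V) (T : set V) :
    Prop :=
  match tau with
  | DominatedRay => dominated_directed_ray H T
  | DoubleStar => double_star H T
  | StarOfDominatedRay => star_of_dominated_ray H T
  | DoubleComb => double_comb H T
  | CombOfTriangles => comb_of_triangles H T
  | ChainOfTriangles => chain_of_triangles H T
  end.

(* Values at elements of [W] that are not vertices (or not ends of an edge) of
   [H] are irrelevant. *)
Record tree_like_model W V (H : digraph W) (D : digraph V) := TreeLikeModel {
  mu : W -> digraph V;
  mu_edge : W -> W -> V * V;  (* (tail, head) *)
  Tin : W -> digraph V;
  Tout : W -> digraph V;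
  model_root : W -> V;
  mu_sub : forall v, dvert H v -> subdigraph (mu v) D;
  mu_edgeP : forall u v, dedge H u v ->
    dedge D (mu_edge u v).1 (mu_edge u v).2;
  mu_disjoint : forall v w, dvert H v -> dvert H w -> v <> w ->
    dvert (mu v) `&` dvert (mu w) = set0;
  mu_union : forall v, dvert H v -> digraph_eq (mu v) (dunion (Tin v) (Tout v));
  Tin_arborescence : forall v, dvert H v -> is_in_arborescence (Tin v) (model_root v);
  Tout_arborescence : forall v, dvert H v ->
    is_out_arborescence (Tout v) (model_root v);
  Tin_Tout : forall v, dvert H v ->
    dvert (Tin v) `&` dvert (Tout v) = [set model_root v];
  mu_edge_tail : forall u v, dedge H u v -> dvert (Tout u) (mu_edge u v).1;
  mu_edge_head : forall u v, dedge H u v -> dvert (Tin v) (mu_edge u v).2 }.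

(* Main.v *)
Require Import Defs.
From mathcomp Require Import all_boot.
From mathcomp Require Import boolp classical_sets functions cardinality.
From mathcomp Require Import zify.

Set Implicit Arguments.
Unset Strict Implicit.
Unset Printing Implicit Defensive.

Local Open Scope classical_set_scope.

(** A walk in [H] lifts to a walk in [D] between the corresponding roots; it
    leaves the root of its first vertex [w] through [Tout w] and enters the root
    of its last vertex through [Tin].  Hence, if [A] and [B] are disjoint sets of
    vertices of [H] avoiding [w], a vertex of [D] met both by a lifted walk from
    [w] into [A] and by a lifted walk from [B] to [w] lies in [Tout w] and [Tin w],
    so it is the root of [w] ([zone_meet]).  Each witness [D] is an explicit
    digraph on columns indexed by [nat] whose small cuts force such meetings.

    On the side of [H], types (ii)-(v) have a vertex [w] joined in both directions
    to a tooth on one side and to all but finitely many teeth on the other; types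
    (iv)-(vi) contain two disjoint strongly connected sets of three vertices; types
    (i), (iii), (v), (vi) contain a directed triangle; in types (i), (iii), (vi)
    there are two vertices that no single vertex separates both from infinity. *)

(** * Walks inside a set *)

(** The witnesses are modelled on the types: [cone], [hub], [broom], [line] and [ladder] are
    themselves of types (i), (ii), (iii), (iv) and (vi), with all attached paths as short as
    possible, while [strip] is a comb of triangles in which consecutive triangles share a vertex.
    The set [U] consists of all vertices for [cone], [hub] and [line]. For [broom] and [strip] it
    has to be smaller: [broom] contains [cone], and contracting each tip of [strip] into its
    out-neighbour yields the doubled ray, so type (i), respectively (iv), is excluded only by asking
    for teeth rooted in leaves or tips. On the side of [H], subdivisions are arbitrary, attached
    paths may be trivial and dominated rays come in two orientations. Hence each type is reduced to
    the existence of a few edges or confined walks, and one such invariant serves several types.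
    Lifted walks may revisit vertices, so [reach] speaks of walks, and the confining set [X] is the
    only record kept of one: a cut vertex of [D] shows up as an element of [X]. *)

Inductive reach V (E : V -> V -> Prop) (X : set V) : V -> V -> Prop :=
  | reach_refl x : X x -> reach E X x x
  | reach_step x y z : X x -> E x y -> reach E X y z -> reach E X x z.

Lemma reach_source V (E : V -> V -> Prop) X x y : reach E X x y -> X x.
Proof. by case. Qed.

Lemma reach_target V (E : V -> V -> Prop) X x y : reach E X x y -> X y.
Proof. by elim. Qed.

Lemma reach_trans V (E : V -> V -> Prop) X x y z :
  reach E X x y -> reach E X y z -> reach E X x z.
Proof. by elim=> // a b c Xa ab _ IH cz; exact: reach_step Xa ab (IH cz). Qed.

Lemma reach_edge V (E : V -> V -> Prop) (X : set V) x y :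
  X x -> X y -> E x y -> reach E X x y.
Proof. by move=> Xx Xy xy; apply: reach_step xy _ => //; exact: reach_refl. Qed.

Lemma reach_map V W (E : V -> V -> Prop) (F : W -> W -> Prop) (f : V -> W)
    (X : set V) (Y : set W) x y :
  (forall a, X a -> Y (f a)) ->
  (forall a b, X a -> X b -> E a b -> reach F Y (f a) (f b)) ->
  reach E X x y -> reach F Y (f x) (f y).
Proof.
move=> XY EF; elim=> [a Xa|a b c Xa ab bc IH]; first exact/reach_refl/XY.
exact: reach_trans (EF _ _ Xa (reach_source bc) ab) IH.
Qed.

Lemma reach_mono V (E F : V -> V -> Prop) (X Y : set V) x y :
  (forall a b, X a -> X b -> E a b -> F a b) -> X `<=` Y ->
  reach E X x y -> reach F Y x y.
Proof.
move=> EF XY; apply: (reach_map (f := id)) => // a b Xa Xb ab.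
by apply: reach_edge; [exact: XY | exact: XY | exact: EF].
Qed.

Lemma reach_sub V (E : V -> V -> Prop) (X Y : set V) x y :
  X `<=` Y -> reach E X x y -> reach E Y x y.
Proof. exact: reach_mono. Qed.

Lemma reach_rev V (E : V -> V -> Prop) X x y :
  reach E X x y -> reach (fun a b => E b a) X y x.
Proof.
elim=> [a|a b c Xa ab bc IH]; first exact: reach_refl.
by apply: reach_trans IH _; apply: reach_edge => //; exact: reach_source bc.
Qed.

Lemma reach_sym V (E : V -> V -> Prop) X x y :
  (forall a b, E a b -> E b a) -> reach E X x y -> reach E X y x.
Proof. by move=> Es xy; apply: reach_mono (reach_rev xy) => // a b _ _; exact: Es. Qed.

(** Every cut argument in a witness is an instance of this: [S] is one side of the cut, and a case
    analysis on the edge leaving [S] finds the vertex that the walk must use. *)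
Lemma reach_cut V (E : V -> V -> Prop) X (S : set V) x y :
  reach E X x y -> S x -> ~ S y ->
  exists p q, [/\ X p, X q, S p, ~ S q & E p q].
Proof.
elim=> [//|a b c Xa ab bc IH Sa nSc].
have [Sb|nSb] := EM (S b); first exact: IH.
by exists a, b; split=> //; exact: reach_source bc.
Qed.

Lemma reach_last_exit V (E : V -> V -> Prop) X w s :
  w <> s -> reach E X w s ->
  exists2 a, E w a & reach E (X `\ w) a s.
Proof.
move=> ws ws_reach.
have ind x : reach E X x s ->
    (reach E (X `\ w) x s) \/ (exists2 a, E w a & reach E (X `\ w) a s).
  move=> xs; elim: xs ws {ws_reach} => [a Xa wa|a b c Xa ab bc IH wc].
    by left; apply: reach_refl; split=> // /esym.
  have [IHl|] := IH wc; last by right.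
  have [aw|aw] := EM (a = w); first by subst a; right; exists b.
  by left; apply: reach_step IHl.
by case: (ind _ ws_reach) => // bad; have [_ []] := reach_source bad.
Qed.

Lemma path_reach V (E : V -> V -> Prop) n p i j :
  is_path E n p -> i <= j <= n ->
  reach E [set p k | k in [set k | i <= k <= j]] (p i) (p j).
Proof.
move=> [pE _] /andP[ij jn].
elim: j ij jn => [|j IH] ij jn.
  by move: ij; rewrite leqn0 => /eqP->; apply: reach_refl; exists 0.
have [->|ne] := eqVneq i j.+1; first by apply: reach_refl; exists j.+1 => //=; lia.
apply: (@reach_trans _ _ _ _ (p j)).
  apply: reach_sub (IH _ _) => [x [k /= kj <-]||]; [exists k => //= | |]; lia.
by apply: reach_edge; [exists j => //= | exists j.+1 => //= | exact: pE]; lia.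
Qed.

Lemma reach_path V (E : V -> V -> Prop) X x y : reach E X x y ->
  exists n p, [/\ is_path E n p, p 0 = x, p n = y & forall i, i <= n -> X (p i)].
Proof.
elim=> [a Xa|a b c Xa ab _ [n [p [[pE pI] p0 pn pX]]]].
  exists 0, (fun=> a); split=> //; split=> // i j.
  by rewrite !leqn0 => /eqP-> /eqP->.
have [[i le_in pia]|apn] := EM (exists2 i, i <= n & p i = a).
  exists (n - i), (fun k => p (i + k)); split; [split|..].
  - by move=> k kn; rewrite addnS; apply: pE; lia.
  - by move=> k l kn ln /pI H; have := H; lia.
  - by rewrite addn0.
  - by rewrite subnKC.
  - by move=> k kn; apply: pX; lia.
exists n.+1, (fun k => if k is k'.+1 then p k' else a); split=> //; last first.
  by case=> // k; rewrite ltnS; exact: pX.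
split=> [[|k]|[|k] [|l]] //.
- by rewrite p0.
- exact: pE.
- by rewrite ltnS => _ ln al; case: apn; exists l.
- by rewrite ltnS => kn _ ka; case: apn; exists k.
- by rewrite !ltnS => kn ln /pI->.
Qed.

Lemma reach_reachable V (E : V -> V -> Prop) X x y : reach E X x y -> reachable E x y.
Proof. by move=> xy; have [n [p [pP p0 pn _]]] := reach_path xy; exists n, p. Qed.

(** * Arborescences *)

(* If the edge between [x] and [y] points to [x], then some path runs from [y]
   to [r] through [x]; its tail and a path from [x] to [r] through [y] close up
   to a cycle through that edge. *)
Lemma acyclic_oriented V (E d : V -> V -> Prop) r n p :
  (forall a b, E a b -> E b a) ->
  (forall m c, ~ is_cycle E m c) ->
  (forall a b, E a b -> d a b \/ d b a) ->
  (forall a b, d a b -> on_path_between E a b r) ->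
  is_path E n p -> p n = r -> forall i, i < n -> d (p i) (p i.+1).
Proof.
move=> Es acyc Ed dr pP pn i lt_in.
have [pE pI] := pP.
have [//|dyx] := Ed _ _ (pE _ lt_in).
set x := p i in dyx *; set y := p i.+1 in dyx *.
have [m [q [qP q0 qm [j jm qj]]]] := dr _ _ dyx.
pose F a b := E a b /\ ~ ((a = x /\ b = y) \/ (a = y /\ b = x)).
have Fs a b : F a b -> F b a.
  by move=> [ab nab]; split; [exact: Es | move=> [[]|[]] *; apply: nab; tauto].
have xy : x <> y by move=> /pI; lia.
have yr : reach F setT y r.
  have := path_reach (i := i.+1) (j := n) pP; rewrite pn -/y lt_in leqnn => /(_ isT).
  apply: reach_mono => // a b [k /= kin <-] [l /= lin <-] ab; split=> //.
  by case=> [[/pI + _]|[_ /pI]]; lia.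
have xr : reach F setT x r.
  have := path_reach (i := j) (j := m) qP; rewrite qm qj jm leqnn => /(_ isT).
  have [qE qI] := qP; have jpos : 0 < j.
    by case: j jm qj => // _; rewrite q0 => yx; case: xy.
  apply: reach_mono => // a b [k /= kin <-] [l /= lin <-] ab; split=> //.
  by rewrite -q0; case=> [[_ /qI]|[/qI]]; lia.
have [k [c [[cF cI] c0 ck _]]] := reach_path (reach_trans xr (reach_sym Fs yr)).
case: k => [|[|k]] in cF cI ck *.
- by case: xy; rewrite -c0 -ck.
- by have [_ []] := cF 0 isT; left.
exfalso; apply: (acyc k.+3 c); split=> // l; rewrite ltnS leq_eqVlt.
case/orP=> [/eqP->|lk]; last by rewrite modn_small; [case: (cF l lk) | lia].
by rewrite modnn c0 ck; exact/Es/pE.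
Qed.

Lemma in_arborescence_reach V (A : digraph V) r v :
  is_in_arborescence A r -> dvert A v -> reach (dedge A) (dvert A) v r.
Proof.
move=> [[_ conn acyc] Ar Aon] Av.
have [n [p [pP p0 pn]]] := conn _ _ Av Ar.
have or := acyclic_oriented (@uedge_sym _ (underlying A)) acyc
  (fun a b (ab : uedge (underlying A) a b) => ab) Aon pP pn.
have := @path_reach _ (dedge A) n p 0 n (conj or pP.2); rewrite p0 pn.
move=> /(_ (leqnn n)).
apply: reach_mono => // x [[|k] /= kn <-]; first by rewrite p0.
by have [] := dedge_vert (or k kn).
Qed.

Lemma on_path_between_rev V (E : V -> V -> Prop) x y z :
  (forall a b, E a b -> E b a) ->
  on_path_between E x y z -> on_path_between E z y x.
Proof.
move=> Es [n [p [[pE pI] p0 pn [i le_in pi]]]].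
exists n, (fun k => p (n - k)); split=> //; rewrite ?subn0 ?subnn //.
  split=> [k kn|k l kn ln /pI H]; last by have := H; lia.
  have -> : n - k = (n - k.+1).+1 by lia.
  by apply/Es/pE; lia.
by exists (n - i); [lia | rewrite subKn].
Qed.

Lemma out_arborescence_reach V (A : digraph V) r v :
  is_out_arborescence A r -> dvert A v -> reach (dedge A) (dvert A) r v.
Proof.
move=> [[_ conn acyc] Ar Aon] Av.
have Es := @uedge_sym _ (underlying A).
have [n [p [pP p0 pn]]] := conn _ _ Av Ar.
(* An out-arborescence is an in-arborescence with all edges reversed, so the orientation lemma is
   applied to the reversed relation. *)
have or i : i < n -> dedge A (p i.+1) (p i).
  apply: (acyclic_oriented (d := fun a b => dedge A b a) Es acyc _ _ pP pn).
    by move=> a b /or_comm.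
  by move=> a b /Aon; exact: on_path_between_rev.
have := @path_reach _ (fun a b => dedge A b a) n p 0 n (conj or pP.2).
rewrite p0 pn.
move=> /(_ (leqnn n)) vr.
apply: reach_mono (reach_rev vr) => // x [[|k] /= kn <-]; first by rewrite p0.
by have [] := dedge_vert (or k kn).
Qed.

(** * Lifting walks along a model *)

Definition model_union W V (H : digraph W) (D : digraph V)
    (M : tree_like_model H D) (A : set W) : set V :=
  \bigcup_(h in A) dvert (mu M h).

Definition out_zone W V (H : digraph W) (D : digraph V)
    (M : tree_like_model H D) w A : set V :=
  dvert (Tout M w) `|` model_union M A.

Definition in_zone W V (H : digraph W) (D : digraph V)
    (M : tree_like_model H D) w A : set V :=
  dvert (Tin M w) `|` model_union M A.

Lemma Tin_sub W V (H : digraph W) (D : digraph V) (M : tree_like_model H D) w :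
  dvert H w -> dvert (Tin M w) `<=` dvert (mu M w).
Proof. by move=> Hw x Tx; rewrite (mu_union M Hw).1; left. Qed.

Lemma Tout_sub W V (H : digraph W) (D : digraph V) (M : tree_like_model H D) w :
  dvert H w -> dvert (Tout M w) `<=` dvert (mu M w).
Proof. by move=> Hw x Tx; rewrite (mu_union M Hw).1; right. Qed.

Lemma root_mu W V (H : digraph W) (D : digraph V) (M : tree_like_model H D) w :
  dvert H w -> dvert (mu M w) (model_root M w).
Proof. by move=> Hw; apply: Tin_sub => //; have [] := Tin_arborescence M Hw. Qed.

Lemma mu_meet W V (H : digraph W) (D : digraph V) (M : tree_like_model H D) v w x :
  dvert H v -> dvert H w -> dvert (mu M v) x -> dvert (mu M w) x -> v = w.
Proof.
move=> Hv Hw vx wx; have [//|vw] := EM (v = w).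
by have /seteqP[/(_ x) + _] := mu_disjoint M Hv Hw vw; case.
Qed.

Lemma root_inj W V (H : digraph W) (D : digraph V) (M : tree_like_model H D) v w :
  dvert H v -> dvert H w -> model_root M v = model_root M w -> v = w.
Proof.
by move=> Hv Hw vw; apply: (mu_meet Hv Hw (root_mu M Hv)); rewrite vw; exact: root_mu.
Qed.

Lemma model_union_mu W V (H : digraph W) (D : digraph V)
    (M : tree_like_model H D) A v x :
  A `<=` dvert H -> dvert H v -> model_union M A x -> dvert (mu M v) x -> A v.
Proof. by move=> AH Hv [h Ah hx] /(mu_meet (AH _ Ah) Hv hx) <-. Qed.

Lemma model_union_root W V (H : digraph W) (D : digraph V)
    (M : tree_like_model H D) A v :
  A `<=` dvert H -> dvert H v -> model_union M A (model_root M v) -> A v.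
Proof. by move=> AH Hv /(model_union_mu AH Hv); apply; exact: root_mu. Qed.

Lemma zone_meet W V (H : digraph W) (D : digraph V) (M : tree_like_model H D)
    w A B x :
  dvert H w -> A `<=` dvert H -> B `<=` dvert H -> ~ A w -> ~ B w ->
  (forall h, A h -> ~ B h) ->
  out_zone M w A x -> in_zone M w B x -> x = model_root M w.
Proof.
move=> Hw AH BH nAw nBw AB [ox|Ax] [ix|Bx].
- have /seteqP[/(_ x) + _] := Tin_Tout M Hw; exact.
- by case: nBw; exact: model_union_mu Bx (Tout_sub Hw ox).
- by case: nAw; exact: model_union_mu Ax (Tin_sub Hw ix).
- by case: Ax Bx => h Ah hx /(model_union_mu BH (AH _ Ah)) /(_ hx) /(AB _ Ah).
Qed.

Lemma lift_edge W V (H : digraph W) (D : digraph V) (M : tree_like_model H D) u v :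
  dedge H u v ->
  reach (dedge D) (dvert (Tout M u) `|` dvert (Tin M v)) (model_root M u) (model_root M v).
Proof.
move=> uv; have [Hu Hv] := dedge_vert uv.
have muD w : dvert H w -> forall a b, dedge (Tin M w) a b \/ dedge (Tout M w) a b ->
    dedge D a b.
  by move=> Hw a b ab; apply: (mu_sub M Hw).2; apply/(mu_union M Hw).2.
apply: (@reach_trans _ _ _ _ (mu_edge M u v).1); last apply: (@reach_step _ _ _ _ (mu_edge M u v).2).
- apply: reach_mono (out_arborescence_reach (Tout_arborescence M Hu) (mu_edge_tail M uv)).
    by move=> a b _ _ ab; apply: (muD _ Hu); right.
  by move=> x; left.
- by left; exact: mu_edge_tail.
- exact: mu_edgeP.
- apply: reach_mono (in_arborescence_reach (Tin_arborescence M Hv) (mu_edge_head M uv)).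
    by move=> a b _ _ ab; apply: (muD _ Hv); left.
  by move=> x; right.
Qed.

Lemma lift_reach W V (H : digraph W) (D : digraph V) (M : tree_like_model H D) A u v :
  A `<=` dvert H -> reach (dedge H) A u v ->
  reach (dedge D) (model_union M A) (model_root M u) (model_root M v).
Proof.
move=> AH; apply: reach_map => [a Aa|a b Aa Ab ab].
  by exists a => //; exact/root_mu/AH.
apply: reach_sub (lift_edge M ab) => x [ax|bx].
  by exists a => //; exact: Tout_sub (AH _ Aa) _ ax.
by exists b => //; exact: Tin_sub (AH _ Ab) _ bx.
Qed.

(** * Invariants of [H] that tell the types apart *)

Definition exits W (H : digraph W) w A t : Prop :=
  exists2 a, dedge H w a & reach (dedge H) A a t.

Definition enters W (H : digraph W) w A t : Prop :=
  exists2 a, dedge H a w & reach (dedge H) A t a.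

Definition arm W (H : digraph W) w A t : Prop :=
  [/\ A `<=` dvert H, ~ A w, exits H w A t & enters H w A t].

Lemma arm_vert W (H : digraph W) w A t : arm H w A t -> dvert H w /\ dvert H t.
Proof.
move=> [AH _ [a wa at_] _]; split; first by case: (dedge_vert wa).
exact: AH (reach_target at_).
Qed.

Lemma lift_exits W V (H : digraph W) (D : digraph V) (M : tree_like_model H D) w A t :
  A `<=` dvert H -> exits H w A t ->
  reach (dedge D) (out_zone M w A) (model_root M w) (model_root M t).
Proof.
move=> AH [a wa at_]; apply: (@reach_trans _ _ _ _ (model_root M a)).
  apply: reach_sub (lift_edge M wa) => x [wx|ax]; [by left | right].
  exists a; first exact: reach_source at_.
  by apply: Tin_sub ax; case: (dedge_vert wa).
by apply: reach_sub (lift_reach M AH at_) => x; right.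
Qed.

Lemma lift_enters W V (H : digraph W) (D : digraph V) (M : tree_like_model H D) w A t :
  A `<=` dvert H -> enters H w A t ->
  reach (dedge D) (in_zone M w A) (model_root M t) (model_root M w).
Proof.
move=> AH [a aw ta]; apply: (@reach_trans _ _ _ _ (model_root M a)).
  by apply: reach_sub (lift_reach M AH ta) => x; right.
apply: reach_sub (lift_edge M aw) => x [ax|wx]; [right | by left].
exists a; first exact: reach_target ta.
by apply: Tout_sub ax; case: (dedge_vert aw).
Qed.

Lemma exits_edge W (H : digraph W) w v : dedge H w v -> exits H w [set v] v.
Proof. by move=> wv; exists v => //; exact: reach_refl. Qed.

Lemma enters_edge W (H : digraph W) w v : dedge H v w -> enters H w [set v] v.
Proof. by move=> wv; exists v => //; exact: reach_refl. Qed.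

Definition starlike W (H : digraph W) (t : nat -> W) : Prop :=
  exists w (A : nat -> set W), (forall n, arm H w (A n) (t n)) /\
    forall m n, m <> n -> forall x, A m x -> ~ A n x.

(** One set [B] serves all late teeth, so a tooth as far out as desired can be chosen after [w] and
    the tooth in [A] have been located in the witness. *)
Definition separating W (H : digraph W) (t : nat -> W) : Prop :=
  exists w m N A B, [/\ arm H w A (t m), (forall x, A x -> ~ B x) &
    forall n, N <= n -> arm H w B (t n)].

Definition strong_triple W (H : digraph W) A x y z : Prop :=
  [/\ A `<=` dvert H, [/\ x <> y, y <> z & z <> x] &
      [/\ reach (dedge H) A x y, reach (dedge H) A y z & reach (dedge H) A z x]].

Definition two_strong_triples W (H : digraph W) : Prop :=
  exists A B x y z x' y' z',
    [/\ strong_triple H A x y z, strong_triple H B x' y' z' &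
        forall h, A h -> ~ B h].

Definition strong_pair W (H : digraph W) A x y : Prop :=
  [/\ A `<=` dvert H, x <> y, reach (dedge H) A x y & reach (dedge H) A y x].

(** A common weakening of [separating] and [two_strong_triples]; the two sets may overlap, as long
    as neither contains the chosen vertex of the other. *)
Definition incomparable_pairs W (H : digraph W) : Prop :=
  exists A B x x' y y',
    [/\ strong_pair H A x x', strong_pair H B y y', ~ A y & ~ B x].

Definition disjoint_edges W (H : digraph W) : Prop :=
  exists x x' y y', [/\ dedge H x x', dedge H y y' &
    [/\ x <> y, x <> y', x' <> y & x' <> y']].

Definition directed_3cycle W (H : digraph W) : Prop :=
  exists x y z, [/\ dedge H x y, dedge H y z, dedge H z x &
    [/\ x <> y, y <> z & z <> x]].

Definition dominated_sequence W (E : W -> W -> Prop) (h : nat -> W) : Prop :=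
  injective h /\
  ((forall i, E (h i) (h i.+1) /\ E (h i.+1) (h 0)) \/
   (forall i, E (h i.+1) (h i) /\ E (h 0) (h i.+1))).

Lemma strong_triple_pair W (H : digraph W) A x y z :
  strong_triple H A x y z -> strong_pair H A x y.
Proof.
move=> [AH [xy _ _] [rxy ryz rzx]]; split=> //; exact: reach_trans ryz rzx.
Qed.

Lemma two_strong_triples_incomparable W (H : digraph W) :
  two_strong_triples H -> incomparable_pairs H.
Proof.
move=> [A [B [x [y [z [x' [y' [z' [sA sB AB]]]]]]]]].
have pA := strong_triple_pair sA; have pB := strong_triple_pair sB.
exists A, B, x, y, x', y'; split=> //.
- by case: pB => _ _ Bx' _ /AB; apply; exact: reach_source Bx'.
- by case: pA => _ _ Ax _; apply: AB; exact: reach_source Ax.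
Qed.

Lemma arm_strong_pair W (H : digraph W) w A t :
  arm H w A t -> strong_pair H (A `|` [set w]) t w.
Proof.
move=> armA; have [Hw Ht] := arm_vert armA.
case: armA => AH nAw [a wa at_] [b bw tb]; split.
- by move=> x [/AH|->].
- by move=> tw; apply: nAw; rewrite -tw; exact: reach_target at_.
- apply: (@reach_trans _ _ _ _ b); first by apply: reach_sub tb => x; left.
  by apply: reach_edge => //; [left; exact: reach_target tb | right].
- apply: (@reach_trans _ _ _ _ a); last by apply: reach_sub at_ => x; left.
  by apply: reach_edge => //; [right | left; exact: reach_source at_].
Qed.

(** Each arm becomes strongly connected enough once [w] is added to it, and the two enlarged arms
    share only [w], so neither contains the tooth of the other. *)
Lemma separating_incomparable W (H : digraph W) t :
  separating H t -> incomparable_pairs H.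
Proof.
move=> [w [m [N [A [B [armA AB armB]]]]]].
have {}armB := armB N (leqnn N).
have At : A (t m) by case: armA => _ _ [a _ at_] _; exact: reach_target at_.
have Bt : B (t N) by case: armB => _ _ [a _ at_] _; exact: reach_target at_.
exists (A `|` [set w]), (B `|` [set w]), (t m), w, (t N), w.
split; [exact: arm_strong_pair..| |].
- by case=> [/AB //|tw]; case: armB => _ + _ _; rewrite -tw.
- by case=> [/(AB _ At) //|tw]; case: armA => _ + _ _; rewrite -tw.
Qed.

(** * The six witnesses *)

Definition full_digraph V (E : V -> V -> Prop) (irr : forall x, ~ E x x) :
    digraph V :=
  DiGraph (dvert := setT) irr (fun x y _ => conj I I).

Lemma full_strongly_connected V (E : V -> V -> Prop) (irr : forall x, ~ E x x) o :
  (forall x, reach E setT x o /\ reach E setT o x) ->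
  strongly_connected (full_digraph irr).
Proof.
move=> Eo x y _ _; apply: reach_reachable.
exact: reach_trans (Eo x).1 (Eo y).2.
Qed.

(** * Type (i): an out-ray with all edges back to its root *)

Inductive cone_rel : nat -> nat -> Prop :=
  | cone_step i : cone_rel i i.+1
  | cone_back i : cone_rel i.+1 0.

Lemma cone_irr x : ~ cone_rel x x.
Proof. by move=> xx; inversion xx; lia. Qed.

Definition cone : digraph nat := full_digraph cone_irr.

Lemma cone_strong : strongly_connected cone.
Proof.
apply: (full_strongly_connected (o := 0)) => x; split.
  by case: x => [|x]; [exact: reach_refl | apply: reach_edge => //; constructor].
elim: x => [|x IH]; first exact: reach_refl.
by apply: reach_trans IH _; apply: reach_edge => //; constructor.
Qed.

Lemma cone_up X x y a : reach cone_rel X x y -> x <= a <= y -> X a.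
Proof.
move=> xy /andP[]; rewrite leq_eqVlt => /orP[/eqP<- _|xa ay].
  exact: reach_source xy.
have [|p [q [_ Xq pa qa pq]]] := reach_cut (S := [set v | v < a]) xy xa.
  by rewrite /=; lia.
case: pq Xq pa qa => i /= Xi ia ai; last by lia.
by have <- : i.+1 = a by lia.
Qed.

(** The only decreasing edges end at [0], so a walk to a smaller number restarts at [0] and climbs
    to its end by single steps. *)
Lemma cone_down X x y a : reach cone_rel X y x -> x < y -> a <= x -> X a.
Proof.
elim=> {x y} [x _|y z x _ yz zx IH xy ax]; first by rewrite ltnn.
case: yz xy zx IH => i xi zx IH; first by apply: IH; lia.
exact: cone_up zx ax.
Qed.

(** The closed walk through the roots of a strong pair covers every number up to the larger root. A
    set carrying a strong pair therefore contains every vertex of [H] whose root is not larger than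
    one of these two; comparing the roots of [x] and [y] puts one of them into the set of the
    other. *)
Lemma cone_excludes W (H : digraph W) :
  tree_like_model H cone -> ~ incomparable_pairs H.
Proof.
move=> M [A [B [x [x' [y [y' [pA pB nAy nBx]]]]]]].
have key C (w z z' : W) : dvert H w -> strong_pair H C z z' -> ~ C w ->
    model_root M w <= model_root M z -> False.
  move=> Hw [CH zz' rzz' rz'z] nCw wz; apply: (nCw).
  apply: (model_union_root (M := M) CH Hw).
  have Hz := CH _ (reach_source rzz'); have Hz' := CH _ (reach_target rzz').
  have lz'z := lift_reach M CH rz'z; have lzz' := lift_reach M CH rzz'.
  have [z'z|zz''|e] := ltngtP (model_root M z') (model_root M z).
- have [wz'|z'w] := leqP (model_root M w) (model_root M z').
    exact: cone_down lzz' z'z wz'.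
  by apply: cone_up lz'z _; rewrite (ltnW z'w).
- exact: cone_down lz'z zz'' wz.
- by case: zz'; rewrite (root_inj Hz' Hz e).
have [[AH _ rA _] [BH _ rB _]] := (pA, pB).
have Hx := AH _ (reach_source rA); have Hy := BH _ (reach_source rB).
have [xy|/ltnW yx] := leqP (model_root M x) (model_root M y).
  exact: key Hx pB nBx xy.
exact: key Hy pA nAy yx.
Qed.

(** * Type (ii): the doubled star *)

Inductive hub_rel : nat -> nat -> Prop :=
  | hub_out i : hub_rel 0 i.+1
  | hub_in i : hub_rel i.+1 0.

Lemma hub_irr x : ~ hub_rel x x.
Proof. by move=> xx; inversion xx; lia. Qed.

Definition hub : digraph nat := full_digraph hub_irr.

Lemma hub_strong : strongly_connected hub.
Proof.
apply: (full_strongly_connected (o := 0)) => -[|x]; split.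
- exact: reach_refl.
- exact: reach_refl.
- by apply: reach_edge => //; constructor.
- by apply: reach_edge => //; constructor.
Qed.

(** Every edge of [hub] has [0] as an end, so every edge of [H] has an end whose branch set contains
    [0]; only one vertex of [H] can have such a branch set. *)
Lemma hub_excludes W (H : digraph W) :
  tree_like_model H hub -> ~ disjoint_edges H.
Proof.
move=> M [x [x' [y [y' [xx' yy' [xy xy' x'y x'y']]]]]].
have key u v : dedge H u v ->
    exists h, [/\ dvert H h, h = u \/ h = v & dvert (mu M h) 0].
  move=> uv; have [Hu Hv] := dedge_vert uv.
  have : dedge hub (mu_edge M u v).1 (mu_edge M u v).2 by exact: mu_edgeP.
  move: (Tout_sub Hu (mu_edge_tail M uv)) (Tin_sub Hv (mu_edge_head M uv)).
  by move=> + + e; case: e => i ? ?; [exists u | exists v]; split; auto.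
have [h [Hh hx hb]] := key _ _ xx'; have [k [Hk ky kb]] := key _ _ yy'.
by have := mu_meet Hh Hk hb kb; case: hx => ->; case: ky => ->.
Qed.

(** * Type (iii): the cone with a doubled pendant edge at every vertex *)

Inductive broom_rel : nat * bool -> nat * bool -> Prop :=
  | broom_step i : broom_rel (i, false) (i.+1, false)
  | broom_back i : broom_rel (i.+1, false) (0, false)
  | broom_out i : broom_rel (i, false) (i, true)
  | broom_in i : broom_rel (i, true) (i, false).

Lemma broom_irr x : ~ broom_rel x x.
Proof. by move=> xx; inversion xx; lia. Qed.

Definition broom : digraph (nat * bool) := full_digraph broom_irr.

Lemma broom_strong : strongly_connected broom.
Proof.
have hub i : reach broom_rel setT (i, false) (0, false) /\
    reach broom_rel setT (0, false) (i, false).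
  split; first by case: i => [|i]; [exact: reach_refl | apply: reach_edge => //; constructor].
  elim: i => [|i IH]; first exact: reach_refl.
  by apply: reach_trans IH _; apply: reach_edge => //; constructor.
apply: (full_strongly_connected (o := (0, false))) => -[i []]; last exact: hub.
split; [apply: reach_trans (hub i).1 | apply: (reach_trans (hub i).2)].
  by apply: reach_edge => //; constructor.
by apply: reach_edge => //; constructor.
Qed.

Lemma broom_leaf_out X i y :
  reach broom_rel X (i, true) y -> y <> (i, true) -> X (i, false).
Proof.
move=> r ne; have [|//|p [q [_ + + _ pq]]] := reach_cut (S := [set (i, true)]) r.
  by [].
by case: pq => // j + [<-].
Qed.

Lemma broom_leaf_in X i y :
  reach broom_rel X y (i, true) -> y <> (i, true) -> X (i, false).
Proof.
move=> r ne; have [//||p [q [+ _ _ + pq]]] := reach_cut (S := ~` [set (i, true)]) r.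
  by move=> /(_ erefl).
move=> Xp /contrapT /= qi; case: pq Xp qi => j // Xj [<-] //.
Qed.

Lemma broom_up X x y i :
  reach broom_rel X x y -> x.1 < i -> i <= y.1 -> X (i, false).
Proof.
move=> r xi iy; have [|p [q [_ Xq pa qa pq]]] := reach_cut (S := [set v | v.1 < i]) r xi.
  by rewrite /=; lia.
case: pq Xq pa qa => j /= Xj ji ij; try lia.
by have <- : j.+1 = i by lia.
Qed.

Lemma broom_down X x y : reach broom_rel X x y -> y.1 < x.1 -> X (0, false).
Proof.
move=> r yx; have [|p [q [_ Xq pa qa pq]]] := reach_cut (S := [set v | y.1 < v.1]) r yx.
  by rewrite /=; lia.
by case: pq Xq pa qa => j //= Xj; lia.
Qed.

(** A column has two vertices, so three distinct roots occupy at least two columns. A closed walk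
    through them has to move back at some point, and all edges to an earlier column end at
    [(0, false)], which cannot lie in two disjoint models. *)
Lemma broom_excludes_triples W (H : digraph W) :
  tree_like_model H broom -> ~ two_strong_triples H.
Proof.
move=> M [A [B [x [y [z [x' [y' [z' [sA sB AB]]]]]]]]].
have key C u v w : strong_triple H C u v w -> model_union M C (0, false).
  move=> [CH [uv vw wu] [ruv rvw rwu]].
  have down a b : reach (dedge H) C a b -> reach (dedge H) C b a ->
      (model_root M a).1 <> (model_root M b).1 -> model_union M C (0, false).
    move=> rab rba /eqP; rewrite neq_ltn => /orP[] lt.
      exact: broom_down (lift_reach M CH rba) lt.
    exact: broom_down (lift_reach M CH rab) lt.
  have [Hu Hv Hw] : [/\ dvert H u, dvert H v & dvert H w].
    by split; apply: CH; [exact: reach_source ruv | exact: reach_source rvw |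
      exact: reach_source rwu].
  have [cuv|] := EM ((model_root M u).1 = (model_root M v).1); last first.
    exact: down ruv (reach_trans rvw rwu).
  have [cvw|] := EM ((model_root M v).1 = (model_root M w).1); last first.
    exact: down rvw (reach_trans rwu ruv).
  have nuv : model_root M u <> model_root M v by move=> /(root_inj Hu Hv).
  have nvw : model_root M v <> model_root M w by move=> /(root_inj Hv Hw).
  have nwu : model_root M w <> model_root M u by move=> /(root_inj Hw Hu).
  move: cuv cvw nuv nvw nwu.
  case: (model_root M u) (model_root M v) (model_root M w) => [i a] [j b] [k c] /=.
  by move=> <- <-; case: a b c => [] [] [].
have [h Ah h0] := key _ _ _ _ sA; have [AH _ _] := sA; have [BH _ _] := sB.
by have /(model_union_mu BH (AH _ Ah))/(_ h0) := key _ _ _ _ sB; exact: AB.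
Qed.

(** The ray vertex below a leaf is its only neighbour. If all roots are leaves, both entering and
    leaving the root of [v] use that ray vertex, which would have to be the root itself. This
    handles type (i), where all vertices are teeth. *)
Lemma broom_excludes_path W (H : digraph W) (M : tree_like_model H broom) u v w :
  dedge H u v -> dedge H v w -> u <> v -> v <> w -> u <> w ->
  ~ (forall h, h = u \/ h = v \/ h = w -> exists i, model_root M h = (i, true)).
Proof.
move=> uv vw nuv nvw nuw leaf.
have [[Hu Hv] [_ Hw]] := (dedge_vert uv, dedge_vert vw).
have [|j jv] := leaf v; first by auto.
have sub x : dvert H x -> [set x] `<=` dvert H by move=> ? ? ->.
have vj x : dvert H x -> v <> x -> model_root M x <> (j, true).
  by rewrite -jv => Hx nvx /(root_inj Hx Hv)/esym.
have lin := lift_enters M (sub _ Hu) (enters_edge uv).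
have lout := lift_exits M (sub _ Hw) (exits_edge vw).
rewrite jv in lin lout.
have : (j, false) = model_root M v.
  apply: (@zone_meet _ _ _ _ M v [set w] [set u]) => //; try exact: sub.
  - exact: nesym.
  - by move=> h -> wu; apply: nuw.
  - by apply: broom_leaf_out lout _; exact: vj.
  - by apply: broom_leaf_in lin _; apply: vj => // /esym.
by rewrite jv.
Qed.

Lemma injective_unbounded (f : nat -> nat) K : injective f ->
  exists N, forall n, N <= n -> K < f n.
Proof.
move=> fI; elim: K => [|K [N HN]].
  have [[n fn]|no] := EM (exists n, f n = 0).
    by exists n.+1 => m nm; rewrite lt0n; apply/eqP; rewrite -fn => /fI; lia.
  by exists 0 => n _; rewrite lt0n; apply/eqP => fn; apply: no; exists n.
have [[n fn]|no] := EM (exists n, f n = K.+1).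
  exists (maxn N n.+1) => m; rewrite geq_max => /andP[Nm nm].
  have : f m <> K.+1 by rewrite -fn => /fI; lia.
  by have := HN m Nm; lia.
exists N => n Nn; have : f n <> K.+1 by move=> fn; apply: no; exists n.
by have := HN n Nn; lia.
Qed.

(** [U] has at most one vertex in each column, so distinct teeth have roots in distinct columns. *)
Lemma teeth_unbounded W V (H : digraph W) (D : digraph V)
    (M : tree_like_model H D) (col : V -> nat) (U : set V) t :
  (forall x y, U x -> U y -> col x = col y -> x = y) ->
  (forall n, U (model_root M (t n))) -> injective t -> (forall n, dvert H (t n)) ->
  forall K, exists N, forall n, N <= n -> K < col (model_root M (t n)).
Proof.
move=> Ucol Ut tI tH K; apply: injective_unbounded => m n /(Ucol _ _ (Ut m) (Ut n)).
by move=> /(root_inj (tH m) (tH n))/tI.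
Qed.

Lemma starlike_inj W (H : digraph W) t : starlike H t ->
  injective t /\ forall n, dvert H (t n).
Proof.
move=> [w [A [armA disA]]]; split=> [m n tmn|n]; last by have [] := arm_vert (armA n).
have At k : A k (t k) by case: (armA k) => _ _ [a _ r] _; exact: reach_target r.
have [//|mn] := EM (m = n).
by case: (disA _ _ mn _ (At m)); rewrite tmn.
Qed.

(** First [a] is chosen beyond [w], then [b] beyond [a]: the arm towards [b] has to pass the column
    of [a], although it is disjoint from the arm of [a]. *)
Lemma starlike_two_beyond W V (H : digraph W) (D : digraph V)
    (M : tree_like_model H D) (col : V -> nat) (U : set V) t :
  (forall x y, U x -> U y -> col x = col y -> x = y) ->
  (forall n, U (model_root M (t n))) -> starlike H t ->
  exists w A B a b, [/\ arm H w A a, arm H w B b, (forall h, A h -> ~ B h),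
    U (model_root M a) &
    col (model_root M w) < col (model_root M a) < col (model_root M b)].
Proof.
move=> Ucol Ut st; have [tI tH] := starlike_inj st.
have unb := teeth_unbounded Ucol Ut tI tH.
case: st => w [A [armA disA]].
have [N HN] := unb (col (model_root M w)).
have [N' HN'] := unb (col (model_root M (t N))).
have ab := HN' _ (leq_maxr N N'); have wa := HN _ (leqnn N).
exists w, (A N), (A (maxn N N')), (t N), (t (maxn N N')); split=> //.
  by apply: disA => NN; move: ab; rewrite -NN ltnn.
by rewrite wa ab.
Qed.

(** With [i] the column of the nearer tooth [a], the walk from [w] to the farther tooth climbs
    through [(i, false)], and the walk from [a] back to [w] leaves its leaf through the same vertex.
    It would be the root of [w], which lies in an earlier column. *)
Lemma broom_excludes_star W (H : digraph W) (M : tree_like_model H broom) t :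
  starlike H t -> ~ (forall n, exists i, model_root M (t n) = (i, true)).
Proof.
move=> st leaf.
have [|w [A [B [a [b [armA armB AB [i ai] lt]]]]]] :=
  starlike_two_beyond (M := M) (col := fst)
    (U := [set x | exists i, x = (i, true)]) _ leaf st.
  by move=> _ _ [i ->] [j ->] /= ->.
have [Hw Ha] := arm_vert armA.
case: armA => AH nAw exA enA; case: armB => BH nBw exB enB.
rewrite ai /= in lt; case/andP: lt => wi ib.
have la := lift_enters M AH enA; have lb := lift_exits M BH exB.
rewrite ai in la.
have wroot : (i, false) = model_root M w.
  apply: (@zone_meet _ _ _ _ M w B A) => //.
  - by move=> h Bh /AB.
  - by apply: broom_up lb _ _ => //; exact: ltnW.
  - by apply: broom_leaf_out la _ => wi'; rewrite wi' /= ltnn in wi.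
by rewrite -wroot /= ltnn in wi.
Qed.

(** * Type (iv): the doubled ray *)

Inductive line_rel : nat -> nat -> Prop :=
  | line_right i : line_rel i i.+1
  | line_left i : line_rel i.+1 i.

Lemma line_irr x : ~ line_rel x x.
Proof. by move=> xx; inversion xx; lia. Qed.

Definition line : digraph nat := full_digraph line_irr.

Lemma line_strong : strongly_connected line.
Proof.
have Ls a b : line_rel a b -> line_rel b a by case=> i; constructor.
apply: (full_strongly_connected (o := 0)) => x.
suff r : reach line_rel setT 0 x by split=> //; exact: reach_sym.
elim: x => [|x IH]; first exact: reach_refl.
by apply: reach_trans IH _; apply: reach_edge => //; constructor.
Qed.

Lemma line_between X x y a : reach line_rel X x y -> x <= a <= y -> X a.
Proof.
move=> xy /andP[]; rewrite leq_eqVlt => /orP[/eqP<- _|xa ay].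
  exact: reach_source xy.
have [|p [q [_ Xq pa qa pq]]] := reach_cut (S := [set v | v < a]) xy xa.
  by rewrite /=; lia.
case: pq Xq pa qa => i /= Xi ia ai; last by lia.
by have <- : i.+1 = a by lia.
Qed.

(** A walk on the line skips nothing, so the one from [w] to [b] runs over the root of [a], which
    belongs neither to the branch set of [w] nor to the arm of [b]. *)
Lemma line_excludes_star W (H : digraph W) (M : tree_like_model H line) t :
  ~ starlike H t.
Proof.
move=> st.
have [|//|w [A [B [a [b [armA armB AB _ /andP[wa ab]]]]]]] :=
  starlike_two_beyond (M := M) (col := id) (U := setT) _ _ st.
  by [].
have [Hw Ha] := arm_vert armA.
case: armA => AH nAw [a' _ ra] _; have Aa := reach_target ra; case: armB => BH nBw exB _.
have lb := lift_exits M BH exB.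
have : out_zone M w B (model_root M a).
  by apply: line_between lb _; rewrite (ltnW wa) (ltnW ab).
case=> [wa'|Ba]; last exact: AB Aa (model_union_root BH Ha Ba).
by move: wa; rewrite (mu_meet Hw Ha (Tout_sub Hw wa') (root_mu M Ha)) ltnn.
Qed.

(** One of three roots on the line lies between the other two. The lifted edge joining those two
    runs over it inside two branch sets that do not contain it. *)
Lemma line_excludes_3cycle W (H : digraph W) :
  tree_like_model H line -> ~ directed_3cycle H.
Proof.
move=> M [x [y [z [xy yz zx [nxy nyz nzx]]]]].
have [[Hx Hy] [_ Hz]] := (dedge_vert xy, dedge_vert yz).
have key a b c : dvert H c -> c <> a -> c <> b -> dedge H a b ->
    ~ (model_root M a <= model_root M c <= model_root M b \/
       model_root M b <= model_root M c <= model_root M a).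
  move=> Hc ca cb ab; have [Ha Hb] := dedge_vert ab.
  have := lift_edge M ab; set X := (X in reach _ X) => r btw.
  have [ac|bc] : X (model_root M c).
  - case: btw; apply: line_between => //.
    by apply: reach_sym r => p q [] i; constructor.
  - by apply: ca; exact: (mu_meet Hc Ha (root_mu M Hc) (Tout_sub Ha ac)).
  - by apply: cb; exact: (mu_meet Hc Hb (root_mu M Hc) (Tin_sub Hb bc)).
have := key _ _ _ Hz nzx (nesym nyz) xy.
have := key _ _ _ Hx nxy (nesym nzx) yz.
have := key _ _ _ Hy nyz (nesym nxy) zx.
lia.
Qed.

(** * Type (v): a row of directed triangles, consecutive ones sharing a vertex *)

Inductive strip_rel : nat * bool -> nat * bool -> Prop :=
  | strip_step i : strip_rel (i, false) (i.+1, false)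
  | strip_up i : strip_rel (i.+1, false) (i, true)
  | strip_down i : strip_rel (i, true) (i, false).

Lemma strip_irr x : ~ strip_rel x x.
Proof. by move=> xx; inversion xx; lia. Qed.

Definition strip : digraph (nat * bool) := full_digraph strip_irr.

Lemma strip_strong : strongly_connected strip.
Proof.
have base i : reach strip_rel setT (i, false) (0, false) /\
    reach strip_rel setT (0, false) (i, false).
  elim: i => [|i [IH IH']]; first by split; exact: reach_refl.
  split; last by apply: reach_trans IH' _; apply: reach_edge => //; constructor.
  apply: reach_trans IH; apply: (@reach_step _ _ _ _ (i, true)) => //; first by constructor.
  by apply: reach_edge => //; constructor.
apply: (full_strongly_connected (o := (0, false))) => -[i []]; last exact: base.
split.
  by apply: reach_step (base i).1 => //; constructor.
by apply: (reach_trans (base i.+1).2); apply: reach_edge => //; constructor.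
Qed.

(** A linear order with the tip [(i, true)] between [(i, false)] and [(i.+1, false)]. Leftward edges
    move by one position and rightward edges by two, jumping over a tip: walks to the right meet
    every [(k, false)] on the way, walks to the left also every tip. *)
Definition strip_pos (x : nat * bool) : nat := x.1.*2 + x.2.

Lemma strip_right X x y k : reach strip_rel X x y ->
  strip_pos x < k.*2 <= strip_pos y -> X (k, false).
Proof.
move=> r /andP[xk ky].
have [|p [q [_ Xq pa qa pq]]] := reach_cut (S := [set v | strip_pos v < k.*2]) r xk.
  by rewrite /=; lia.
case: pq Xq pa qa; rewrite /strip_pos /= => j Xj pj qj; try lia.
by have <- : j.+1 = k by lia.
Qed.

Lemma strip_left X x y k : reach strip_rel X x y ->
  strip_pos y <= k.*2 < strip_pos x -> X (k, false).
Proof.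
move=> r /andP[yk kx].
have [|p [q [_ Xq pa qa pq]]] := reach_cut (S := [set v | k.*2 < strip_pos v]) r kx.
  by rewrite /=; lia.
case: pq Xq pa qa; rewrite /strip_pos /= => j Xj pj qj; try lia.
by have <- : j = k by lia.
Qed.

Lemma strip_left_tip X x y k : reach strip_rel X x y ->
  strip_pos y <= k.*2.+1 < strip_pos x -> X (k, true).
Proof.
move=> r /andP[yk kx].
have [|p [q [_ Xq pa qa pq]]] := reach_cut (S := [set v | k.*2.+1 < strip_pos v]) r kx.
  by rewrite /=; lia.
case: pq Xq pa qa; rewrite /strip_pos /= => j Xj pj qj; try lia.
by have <- : j = k by lia.
Qed.

Lemma strip_tip_out X i y :
  reach strip_rel X (i, true) y -> y <> (i, true) -> X (i, false).
Proof.
move=> r ne; have [|//|p [q [_ + + _ pq]]] := reach_cut (S := [set (i, true)]) r.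
  by [].
by case: pq => // j + [<-].
Qed.

(** Take teeth [a], [b], [c] in increasing columns and a path of [H] from [a] to [c]. The lifted
    path may jump over the tip of [b], but its reversal, available as [H] is symmetric, may not; so
    [b] lies on the path, and this is refuted by a meeting at the vertex [(j, false)]. *)
Lemma strip_excludes_double W (H : digraph W) (M : tree_like_model H strip)
    (t : nat -> W) :
  (forall x y, dedge H x y -> dedge H y x) -> strongly_connected H ->
  injective t -> (forall n, dvert H (t n)) ->
  ~ (forall n, exists i, model_root M (t n) = (i, true)).
Proof.
move=> Hs Hc tI tH tip.
have unb K : exists N, forall n, N <= n -> K < (model_root M (t n)).1.
  apply: (teeth_unbounded (U := [set x | exists i, x = (i, true)])) => //.
  by move=> _ _ [i ->] [j ->] /= ->.
have [n1 /(_ _ (leqnn _)) ab] := unb (model_root M (t 0)).1.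
have [n2 /(_ _ (leqnn _)) bc] := unb (model_root M (t n1)).1.
move: (t 0) (t n1) (t n2) (tip 0) (tip n1) (tip n2) (tH 0) (tH n1) (tH n2) ab bc.
move=> {tip tH tI unb} a b c [i ai] [j bj] [k ck] Ha Hb Hc'.
rewrite ai bj ck /= => ij jk.
have [n [p [pP p0 pn]]] := Hc _ _ Ha Hc'.
have [pE pI] := pP.
have ab : a <> b by move=> ab; move: ai; rewrite ab bj => -[]; lia.
have bc : b <> c by move=> bc; move: ck; rewrite -bc bj => -[]; lia.
have pH m : m <= n -> dvert H (p m).
  case: m => [|m] mn; first by rewrite p0.
  by have [] := dedge_vert (pE m mn).
have [[m mn pm]|nb] := EM (exists2 m, m <= n & p m = b).
  have m0 : m != 0 by apply/eqP => mz; apply: ab; rewrite -p0 -pm mz.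
  have mn' : m != n by apply/eqP => mz; apply: bc; rewrite -pn -pm mz.
  pose A := [set p l | l in [set l | 0 <= l <= m.-1]].
  pose B := [set p l | l in [set l | m.+1 <= l <= n]].
  have AH : A `<=` dvert H by move=> _ [l /= lm <-]; apply: pH; lia.
  have BH : B `<=` dvert H by move=> _ [l /= lm <-]; apply: pH; lia.
  have enA : enters H b A a.
    exists (p m.-1); first by have := pE m.-1; rewrite prednK ?pm; [apply; lia | lia].
    by rewrite -p0; apply: path_reach pP _; lia.
  have exB : exits H b B c.
    exists (p m.+1); first by rewrite -pm; apply: pE; lia.
    by rewrite -pn; apply: path_reach pP _; lia.
  have lin := lift_enters M AH enA; have lout := lift_exits M BH exB.
  rewrite ai bj in lin; rewrite bj ck in lout.
  (* The walk from [a] comes from the left and passes [(j, false)] on its way to the tip; the walk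
     on to [c] leaves the tip through [(j, false)]. *)
  have : (j, false) = model_root M b.
    apply: (@zone_meet _ _ _ _ M b B A) => //.
    - by move=> [l /= lm]; rewrite -pm => /pI; lia.
    - by move=> [l /= lm]; rewrite -pm => /pI; lia.
    - by move=> _ [l /= lm <-] [l' /= lm' /pI]; lia.
    - by apply: strip_tip_out lout _ => -[]; lia.
    - by apply: strip_right lin _; rewrite /strip_pos /=; lia.
  by rewrite bj.
pose A := [set p l | l in [set l | 0 <= l <= n]].
have AH : A `<=` dvert H by move=> _ [l /= lm <-]; apply: pH; lia.
have rac : reach (dedge H) A a c by rewrite -p0 -pn; apply: path_reach pP _; lia.
have lca := lift_reach M AH (reach_sym Hs rac).
suff [l /= ln pl] : A b by case: nb; exists l.
apply: (model_union_root (M := M) AH Hb).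
by rewrite bj; apply: strip_left_tip lca _; rewrite ai ck /strip_pos /=; lia.
Qed.

Definition two_ended W (H : digraph W) : Prop :=
  exists y1 y2, forall h, exists y (f : nat -> W) N,
    [/\ y = y1 \/ y = y2, injective f, forall n, dvert H (f n) &
        forall n, N <= n -> reach (dedge H) (dvert H `\ h) y (f n) \/
                            reach (dedge H) (dvert H `\ h) (f n) y].

(** For [k] beyond both roots, [(k, false)] stops walks in either direction between these roots and
    the far part of the strip. It lies in at most one branch set, and deleting the vertex [h] with
    that branch set leaves both [y1] and [y2] cut off from all but finitely many roots. *)
Lemma strip_excludes_two_ended W (H : digraph W) :
  tree_like_model H strip -> ~ two_ended H.
Proof.
move=> M [y1 [y2 Hy]].
pose k := (strip_pos (model_root M y1) + strip_pos (model_root M y2)).+1.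
(* If no branch set contains [(k, false)], any [h] will do. *)
have [h nk] : exists h, ~ model_union M (dvert H `\ h) (k, false).
  have [[h Hh hk]|no] := EM (exists2 h, dvert H h & dvert (mu M h) (k, false)).
    by exists h => -[g [Hg gh] gk]; apply: gh; exact: mu_meet gk hk.
  by exists y1 => -[g [Hg _] gk]; apply: no; exists g.
have [y [f [N [yy fI fH fr]]]] := Hy h.
have posI : injective (fun n => strip_pos (model_root M (f n))).
  move=> m n; rewrite /strip_pos => e; apply: fI; apply: (root_inj (M := M)) => //.
  by move: e; case: (model_root M (f m)) (model_root M (f n)) => a [] [b []] /= ?;
    congr (_, _); lia.
have [N' HN'] := injective_unbounded k.*2 posI.
have [Nm N'm] : N <= maxn N N' /\ N' <= maxn N N' by rewrite leq_maxl leq_maxr.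
have yk : strip_pos (model_root M y) < k.*2 by case: yy => ->; lia.
have fk := HN' _ N'm.
have sub : dvert H `\ h `<=` dvert H by move=> x [].
case: (fr _ Nm) => r; apply: nk; have l := lift_reach M sub r.
  by apply: strip_right l _; rewrite yk ltnW.
by apply: strip_left l _; rewrite fk ltnW.
Qed.

(** Deleting [h 0] leaves the ray starting at [h 1]; deleting any other vertex leaves edges between
    [h 0] and almost all of the ray. *)
Lemma dominated_two_ended W (H : digraph W) h :
  dominated_sequence (dedge H) h -> two_ended H.
Proof.
move=> [hI hE]; exists (h 0), (h 1) => g.
have hH n : dvert H (h n).
  by case: hE => /(_ n)[e _]; have [] := dedge_vert e.
have [->|h0g] := EM (g = h 0).
  exists (h 1), (fun n => h n.+1), 0; split; [by right|by move=> m n /hI[]|by []|].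
  have Xh n : (dvert H `\ h 0) (h n.+1) by split=> // /hI.
  case: hE => hE n _; [left|right]; elim: n => [|n IH]; try exact: reach_refl.
    by apply: reach_trans IH _; apply: reach_edge => //; case: (hE n.+1).
  by apply: reach_trans IH; apply: reach_edge => //; case: (hE n.+1).
have [N HN] : exists N, forall n, N <= n -> h n.+1 <> g.
  have [[m hm]|no] := EM (exists m, h m = g).
    by exists m => n mn; rewrite -hm => /hI; lia.
  by exists 0 => n _ hn; apply: no; exists n.+1.
exists (h 0), (fun n => h n.+1), N; split; [by left|by move=> m n /hI[]|by []|].
have Xh n : N <= n -> (dvert H `\ g) (h n.+1) by move=> /HN.
have X0 : (dvert H `\ g) (h 0) by split=> // /esym.
move=> n Nn; case: hE => hE; [right|left]; apply: reach_edge => //; try exact: Xh.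
  by case: (hE n).
by case: (hE n).
Qed.

(** * Type (vi): a chain of triangles with trivial double paths *)

Inductive corner := CornerA | CornerB | CornerC.

Inductive ladder_rel : nat * corner -> nat * corner -> Prop :=
  | ladder_ab i : ladder_rel (i, CornerA) (i, CornerB)
  | ladder_bc i : ladder_rel (i, CornerB) (i, CornerC)
  | ladder_ca i : ladder_rel (i, CornerC) (i, CornerA)
  | ladder_left i : ladder_rel (i.+1, CornerA) (i, CornerA)
  | ladder_right i : ladder_rel (i, CornerC) (i.+1, CornerC).

Lemma ladder_irr x : ~ ladder_rel x x.
Proof. by move=> xx; inversion xx; lia. Qed.

Definition ladder : digraph (nat * corner) := full_digraph ladder_irr.

Lemma ladder_strong : strongly_connected ladder.
Proof.
have e x y : ladder_rel x y -> reach ladder_rel setT x y by exact: reach_edge.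
have toA i : reach ladder_rel setT (i, CornerA) (0, CornerA).
  elim: i => [|i IH]; first exact: reach_refl.
  by apply: reach_trans IH; apply: e; constructor.
have fromC i : reach ladder_rel setT (0, CornerC) (i, CornerC).
  elim: i => [|i IH]; first exact: reach_refl.
  by apply: reach_trans IH _; apply: e; constructor.
have AB i := e _ _ (ladder_ab i); have BC i := e _ _ (ladder_bc i).
have CA i := e _ _ (ladder_ca i).
have fromA i : reach ladder_rel setT (0, CornerA) (i, CornerC).
  exact: reach_trans (reach_trans (AB 0) (BC 0)) (fromC i).
apply: (full_strongly_connected (o := (0, CornerA))) => -[i []]; split=> //.
- exact: reach_trans (fromA i) (CA i).
- exact: reach_trans (reach_trans (BC i) (CA i)) (toA i).
- exact: reach_trans (reach_trans (fromA i) (CA i)) (AB i).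
- exact: reach_trans (CA i) (toA i).
Qed.

(** Columns are passed to the right only between corners [CornerC], and to the left only between
    corners [CornerA]. *)
Lemma ladder_up X x y m : reach ladder_rel X x y -> x.1 <= m < y.1 ->
  X (m, CornerC) /\ X (m.+1, CornerC).
Proof.
move=> r /andP[xm my].
have [|p [q [Xp Xq pa qa pq]]] := reach_cut (S := [set v | v.1 <= m]) r xm.
  by rewrite /=; lia.
case: pq Xp Xq pa qa => /= i Xi Xj im mi; try lia.
by have <- : i = m by lia.
Qed.

Lemma ladder_down X x y m : reach ladder_rel X x y -> y.1 <= m < x.1 ->
  X (m, CornerA) /\ X (m.+1, CornerA).
Proof.
move=> r /andP[ym mx].
have [|p [q [Xp Xq pa qa pq]]] := reach_cut (S := [set v | m < v.1]) r mx.
  by rewrite /=; lia.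
case: pq Xp Xq pa qa => /= i Xi Xj im mi; try lia.
by have <- : i = m by lia.
Qed.

Lemma ladder_tip_out X i y :
  reach ladder_rel X (i, CornerB) y -> y <> (i, CornerB) -> X (i, CornerC).
Proof.
move=> r ne; have [|//|p [q [_ + + _ pq]]] := reach_cut (S := [set (i, CornerB)]) r.
  by [].
by case: pq => // j + [<-].
Qed.

Lemma ladder_tip_in X i y :
  reach ladder_rel X y (i, CornerB) -> y <> (i, CornerB) -> X (i, CornerA).
Proof.
move=> r ne; have [//||p [q [+ _ _ + pq]]] := reach_cut (S := ~` [set (i, CornerB)]) r.
  by move=> /(_ erefl).
move=> Xp /contrapT /= qi; case: pq Xp qi => j // Xj [<-] //.
Qed.

(** If all roots are tips, an inner vertex of a path of [H] lies in a column strictly before those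
    of both its neighbours; [h1] and [h2] are inner and adjacent, which is impossible. *)
Lemma ladder_excludes_path W (H : digraph W) (M : tree_like_model H ladder)
    h0 h1 h2 h3 :
  dedge H h0 h1 -> dedge H h1 h2 -> dedge H h2 h3 ->
  [/\ h0 <> h1, h1 <> h2 & h2 <> h3] -> h0 <> h2 -> h1 <> h3 ->
  (forall h, dvert H h -> exists i, model_root M h = (i, CornerB)) -> False.
Proof.
move=> e01 e12 e23 [n01 n12 n23] n02 n13 tip.
have [[H0 H1] [H2 H3]] := (dedge_vert e01, dedge_vert e23).
have sub x : dvert H x -> [set x] `<=` dvert H by move=> ? ? ->.
(* A tip enters its triangle at [CornerA] and leaves it at [CornerC], so a walk
   going on to the left would meet [CornerA] again, and a walk coming from the
   left would already have met [CornerC]. *)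
have key u v w : dedge H u v -> dedge H v w -> u <> v -> v <> w -> u <> w ->
    (model_root M v).1 < (model_root M w).1 /\
    (model_root M v).1 < (model_root M u).1.
  move=> uv vw nuv nvw nuw.
  have [[Hu Hv] [_ Hw]] := (dedge_vert uv, dedge_vert vw).
  have lin := lift_enters M (sub _ Hu) (enters_edge uv).
  have lout := lift_exits M (sub _ Hw) (exits_edge vw).
  have vI x : dvert H x -> v <> x -> model_root M x <> model_root M v.
    by move=> Hx nvx /(root_inj Hx Hv)/esym.
  have meet q : out_zone M v [set w] q -> in_zone M v [set u] q ->
      q = model_root M v.
    apply: zone_meet => //; try exact: sub; first exact: nesym.
    by move=> h -> wu; apply: nuw.
  have nu : model_root M u <> model_root M v by apply: vI => // /esym.
  have nw : model_root M w <> model_root M v by exact: vI.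
  have [[[i ui] [j vj]] [k wk]] := (tip _ Hu, tip _ Hv, tip _ Hw).
  rewrite ui vj wk /= in lin lout nu nw meet *.
  have aj := ladder_tip_in lin nu; have cj := ladder_tip_out lout nw.
  split; rewrite ltnNge; apply/negP.
    rewrite leq_eqVlt => /orP[/eqP kj|kj]; first by apply: nw; rewrite kj.
    case: j kj {nu nw vj} lin lout meet aj cj => // j kj lin lout meet aj cj.
    by have [|_ aj'] := ladder_down (m := j) lout; [rewrite /=; lia | have := meet _ aj' aj].
  rewrite leq_eqVlt => /orP[/eqP kj|kj]; first by apply: nu; rewrite kj.
  case: j kj {nu nw vj} lin lout meet aj cj => // j kj lin lout meet aj cj.
  by have [|_ cj'] := ladder_up (m := j) lin; [rewrite /=; lia | have := meet _ cj cj'].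
have [lt _] := key _ _ _ e01 e12 n01 n12 n02.
have [_ gt] := key _ _ _ e12 e23 n12 n23 n13.
lia.
Qed.

(** Let [m] be the column of the root of [w] and [j] that of the tooth in [A]. If [m < j], the
    [CornerC] of column [j] is met from this tooth to [w] and from [w] to the far tooth, so it is
    the root of [w], in the wrong column. If [j <= m], both the [CornerA] and the [CornerC] of
    column [m] are such meeting points, and [w] would have two roots. *)
Lemma ladder_excludes_separating W (H : digraph W) (M : tree_like_model H ladder) t :
  separating H t -> injective t -> (forall n, dvert H (t n)) ->
  ~ (forall n, exists i, model_root M (t n) = (i, CornerB)).
Proof.
move=> [w [a [N [A [B [armA AB armB]]]]]] tI tH tip.
have unb K : exists N, forall n, N <= n -> K < (model_root M (t n)).1.
  apply: (teeth_unbounded (U := [set x | exists i, x = (i, CornerB)])) => //.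
  by move=> _ _ [i ->] [j ->] /= ->.
have [N' HN'] := unb ((model_root M w).1 + (model_root M (t a)).1).
have {}armB := armB _ (leq_maxl N N'); have := HN' _ (leq_maxr N N').
set b := maxn N N' in armB * => lt.
have [Hw Ha] := arm_vert armA; have [_ Hb] := arm_vert armB.
case: armA => AH nAw exA enA; case: armB => BH nBw exB enB.
have ta : t a <> w.
  by move=> taw; apply: nAw; rewrite -taw; case: exA => x _ r; exact: reach_target r.
have BA h : B h -> ~ A h by move=> Bh /AB.
have [oA iA] := (lift_exits M AH exA, lift_enters M AH enA).
have [oB iB] := (lift_exits M BH exB, lift_enters M BH enB).
have nr : model_root M w <> model_root M (t a) by move=> /(root_inj Hw Ha)/esym.
have meet q : out_zone M w A q -> in_zone M w B q -> q = model_root M w.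
  exact: zone_meet.
have meet' q : out_zone M w B q -> in_zone M w A q -> q = model_root M w.
  exact: zone_meet.
have [j aj] := tip a; rewrite aj in nr oA iA lt.
move: nr oA iA oB iB meet meet' lt.
case: (model_root M w) => m x; case: (model_root M (t b)) => k y.
move=> nr oA iA oB iB meet meet' /= lt.
have cj := ladder_tip_out iA nr; have aj' := ladder_tip_in oA nr.
have [mj|jm] := ltnP m j.
  have [|cj' _] := ladder_up (m := j) oB; first by rewrite /=; lia.
  by have [] := meet' _ cj' cj; lia.
have [cm _] : out_zone M w B (m, CornerC) /\ out_zone M w B (m.+1, CornerC).
  by apply: ladder_up oB _; rewrite /=; lia.
have [am _] : in_zone M w B (m, CornerA) /\ in_zone M w B (m.+1, CornerA).
  by apply: ladder_down iB _; rewrite /=; lia.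
move: jm; rewrite leq_eqVlt => /orP[/eqP jm|jm].
  subst m; have := meet _ aj' am; have := meet' _ cm cj; congruence.
case: m nr oA oB iA iB cm am meet meet' lt jm => // m _ oA _ iA _ cm am meet meet' _ jm.
have [|_ cm'] := ladder_up (m := m) iA; first by rewrite /=; lia.
have [|_ am'] := ladder_down (m := m) oA; first by rewrite /=; lia.
have := meet _ am' am; have := meet' _ cm cm'; congruence.
Qed.

(** * Structure of the six types *)

(** A path from [p 0] can reach [p i.+1] only across the edge from [p i], so it has visited [p i]
    before and cannot end there. This fixes the orientation of in-rays and out-rays: an edge
    pointing the wrong way would require such a path. *)
Lemma ray_no_detour V (G : ugraph V) p i :
  is_ray G p -> ~ on_path_between (uedge G) (p 0) (p i.+1) (p i).
Proof.
move=> [pI _ pE] [n [q [qP q0 qn [j jn qj]]]].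
have r := path_reach (i := 0) (j := j) qP jn; rewrite q0 qj in r.
have [||a [b [[l /= lj la] _ [m mi ma] nb]]] := reach_cut (S := p @` [set k | k <= i]) r.
- by exists 0.
- by move=> [k /= ki /pI]; lia.
move=> /pE[c [[ac bc]|[ac bc]]]; last first.
  by apply: nb; exists c => //=; move: ma; rewrite ac => /pI; lia.
have ci : c = i.
  have mc : m = c by apply: pI; rewrite ma.
  apply/eqP; rewrite eqn_leq; apply/andP; split; first by rewrite -mc.
  by rewrite leqNgt; apply/negP => ci; apply: nb; exists c.+1.
have : l = n by apply: qP.2; [lia | lia | rewrite la qn ac ci].
move=> ln; have jn' : j = n by lia.
have : p i.+1 = p i by rewrite -qj -qn jn'.
by move=> /pI; lia.
Qed.

Lemma dominated_ray_sequence V (Q : digraph V) : is_dominated_ray Q ->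
  exists2 h, dominated_sequence (dedge Q) h & dvert Q = range h.
Proof.
move=> [R [r [QR dom]]]; rewrite QR.
have [p rayp p0] : exists2 p, is_ray (underlying R) p & p 0 = r /\
   ((forall i, dedge Q (p i) (p i.+1) /\ dedge Q (p i.+1) (p 0)) \/
   (forall i, dedge Q (p i.+1) (p i) /\ dedge Q (p 0) (p i.+1))).
  case: dom => -[[[_ _ or] [p rayp p0]] QE]; exists p => //; split=> //; [left|right];
    move=> i; have [pI pV pE] := rayp; split; apply/QE.
  - have [|/or] : uedge (underlying R) (p i) (p i.+1) by apply/pE; exists i; left.
    + by left.
    + by rewrite -p0 => /(ray_no_detour rayp).
  - right; split=> //; last by rewrite -p0 => /pI.
    by rewrite [dvert R]pV; exists i.+1.
  - have [/or det|] : uedge (underlying R) (p i) (p i.+1) by apply/pE; exists i; left.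
    + case: (ray_no_detour (i := i) rayp); rewrite p0.
      exact: on_path_between_rev (@uedge_sym _ (underlying R)) det.
    + by left.
  - right; split=> //; last by rewrite -p0 => /pI.
    by rewrite [dvert R]pV; exists i.+1.
by move: p0 => [p0 Qp]; exists p; [split=> //; case: rayp | case: rayp].
Qed.

Lemma dominated_strong W (E : W -> W -> Prop) h i j :
  dominated_sequence E h -> reach E (range h) (h i) (h j).
Proof.
move=> [_ hE]; have Xh n : range h (h n) by exists n.
suff base n : reach E (range h) (h n) (h 0) /\ reach E (range h) (h 0) (h n).
  exact: reach_trans (base i).1 (base j).2.
case: hE => hE; split.
- case: n => [|n]; first exact: reach_refl.
  by apply: reach_edge => //; case: (hE n).
- elim: n => [|n IH]; first exact: reach_refl.
  by apply: reach_trans IH _; apply: reach_edge => //; case: (hE n).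
- elim: n => [|n IH]; first exact: reach_refl.
  by apply: reach_trans IH; apply: reach_edge => //; case: (hE n).
- case: n => [|n]; first exact: reach_refl.
  by apply: reach_edge => //; case: (hE n).
Qed.

Lemma dominated_3cycle W (H : digraph W) h :
  dominated_sequence (dedge H) h -> directed_3cycle H.
Proof.
move=> [hI hE]; have ne i j : i != j -> h i <> h j by move=> ij /hI/eqP; apply/negP.
case: hE => hE.
  by exists (h 0), (h 1), (h 2); split; [case: (hE 0)|case: (hE 1)|case: (hE 1)|
    split; exact: ne].
by exists (h 0), (h 2), (h 1); split; [case: (hE 1)|case: (hE 1)|case: (hE 0)|
    split; exact: ne].
Qed.

Lemma dominated_path W (H : digraph W) h : dominated_sequence (dedge H) h ->
  exists x y z u, [/\ dedge H x y, dedge H y z & dedge H z u] /\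
    [/\ [/\ x <> y, y <> z & z <> u], x <> z, y <> u & x <> u].
Proof.
move=> [hI hE]; have ne i j : i != j -> h i <> h j by move=> ij /hI/eqP; apply/negP.
case: hE => hE.
  exists (h 0), (h 1), (h 2), (h 3); split; last by split; try split; exact: ne.
  by split; [case: (hE 0)|case: (hE 1)|case: (hE 2)].
exists (h 3), (h 2), (h 1), (h 0); split; last by split; try split; exact: ne.
by split; [case: (hE 2)|case: (hE 1)|case: (hE 0)].
Qed.

Lemma dominated_disjoint_edges W (H : digraph W) h :
  dominated_sequence (dedge H) h -> disjoint_edges H.
Proof.
move=> /dominated_path[x [y [z [u [[xy _ zu] [[_ yz _] xz yu xu]]]]]].
by exists x, y, z, u.
Qed.

Lemma strong_triple_edge W (H : digraph W) A x y z : strong_triple H A x y z ->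
  exists2 x', A x' & exists2 y', A y' & dedge H x' y'.
Proof.
move=> [_ [xy _ _] [r _ _]].
have [|//|p [q [Ap Aq _ _ pq]]] := reach_cut (S := [set x]) r; first by [].
by move=> /= /esym.
by exists p => //; exists q.
Qed.

Lemma two_strong_triples_edges W (H : digraph W) :
  two_strong_triples H -> disjoint_edges H.
Proof.
move=> [A [B [x [y [z [x' [y' [z' [sA sB AB]]]]]]]]].
have [a Aa [b Ab ab]] := strong_triple_edge sA.
have [c Bc [d Bd cd]] := strong_triple_edge sB.
exists a, b, c, d; split=> //; split=> e.
- by apply: AB Aa _; rewrite e.
- by apply: AB Aa _; rewrite e.
- by apply: AB Ab _; rewrite e.
- by apply: AB Ab _; rewrite e.
Qed.

(* Types (ii)-(v) are of this form over a subdivided star or a comb [G]: the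
   block [B u] is a singleton, a dominated ray or a directed triangle. *)
Definition blowup W (H : digraph W) (G : ugraph W) (B : W -> set W)
    (att : W -> W -> W) : Prop :=
  [/\ forall u v x, uvert G u -> uvert G v -> B u x -> B v x -> u = v,
      forall u, uvert G u -> B u `<=` dvert H,
      forall u x y, uvert G u -> B u x -> B u y -> reach (dedge H) (B u) x y &
      forall u v, uedge G u v -> B u (att u v) /\ dedge H (att u v) (att v u)].

(** [S] is the side of [v] and its complement the side of [u], both connected; the teeth are spread
    as [separating] demands. *)
Definition splitting W (G : ugraph W) (t : nat -> W) : Prop :=
  exists u v S m N,
    [/\ uedge G u v, S `<=` uvert G, ~ S u & S v] /\
    [/\ forall x, S x -> reach (uedge G) S v x,
        forall x, uvert G x -> ~ S x -> reach (uedge G) (uvert G `\` S) u x,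
        S (t m) & forall n, N <= n -> uvert G (t n) /\ ~ S (t n)].

Lemma blowup_reach W (H : digraph W) G B att S x y a b :
  blowup H G B att -> S `<=` uvert G -> reach (uedge G) S x y ->
  B x a -> B y b -> reach (dedge H) (\bigcup_(u in S) B u) a b.
Proof.
move=> [_ _ Bs attE] SG r; elim: r a b => {x y} [x Sx|x y z Sx xy yz IH] a b Ba Bb.
  by apply: reach_sub (Bs x _ _ (SG _ Sx) Ba Bb) => c; exists x.
have [Bxy e] := attE _ _ xy; have [Byx _] := attE _ _ (uedge_sym xy).
apply: (@reach_trans _ _ _ _ (att x y)).
  by apply: reach_sub (Bs x _ _ (SG _ Sx) Ba Bxy) => c; exists x.
apply: reach_step e (IH _ _ Byx Bb).
by exists x.
Qed.

Lemma reach_first_entry V (E : V -> V -> Prop) X w s :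
  w <> s -> reach E X s w ->
  exists2 a, E a w & reach E (X `\ w) s a.
Proof.
move=> ws r; have [a wa ra] := reach_last_exit ws (reach_rev r).
by exists a => //; exact: reach_rev ra.
Qed.

(** The vertex [w] is the end in the block of [u] of the edge replacing [uv]. Since blocks are
    strongly connected, [w] and the late teeth reach each other in the blocks outside [S]; cutting
    these walks at the last exit from [w], or the first entry to it, removes [w] from the confining
    set. *)
Lemma blowup_separating W (H : digraph W) G B att t :
  blowup H G B att -> splitting G t -> injective t -> (forall n, B (t n) (t n)) ->
  separating H t.
Proof.
move=> blow [u [v [S [m [N [[uv SG nSu Sv] [Sr cSr Sm cS]]]]]]] tI Bt.
have [BI BH _ attE] := blow.
have Gu := uedge_vert uv; have Es := @uedge_sym _ G.
have [Bu e] := attE _ _ uv; have [Bv e'] := attE _ _ (uedge_sym uv).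
set w := att u v in Bu e e'.
(* [w] may itself be a tooth, for instance at a trivial path of a comb, so that tooth has to be
   skipped. *)
have [N' HN'] : exists N', forall n, N' <= n -> w <> t n.
  have [[k wk]|no] := EM (exists k, w = t k).
    by exists k.+1 => n kn; rewrite wk => /tI; lia.
  by exists 0 => n _ wn; apply: no; exists n.
have cG : uvert G `\` S `<=` uvert G by move=> x [].
exists w, m, (maxn N N'), (\bigcup_(u in S) B u),
  ((\bigcup_(u in uvert G `\` S) B u) `\ w); split.
- have nAw : ~ (\bigcup_(u in S) B u) w.
    by move=> [x Sx Bx]; apply: nSu; rewrite (BI _ _ _ Gu (SG _ Sx) Bu Bx).
  split=> //; first by move=> y [x Sx]; apply: BH; exact: SG.
    exists (att v u) => //.
    exact: (blowup_reach blow SG (Sr _ Sm) Bv (Bt m)).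
  exists (att v u) => //.
  exact: (blowup_reach blow SG (reach_sym Es (Sr _ Sm)) (Bt m) Bv).
- move=> x [y Sy By] [[z [Gz nSz] Bz] _]; apply: nSz.
  by rewrite -(BI _ _ _ (SG _ Sy) Gz By Bz).
- move=> n; rewrite geq_max => /andP[/cS[Gn nSn] /HN' wn].
  split.
  + by move=> y [[x [Gx _] Bx] _]; exact: BH Bx.
  + by move=> [_ /(_ erefl)].
  + apply: reach_last_exit wn _.
    exact: (blowup_reach blow cG (cSr _ Gn nSn) Bu (Bt n)).
  + apply: reach_first_entry wn _.
    exact: (blowup_reach blow cG (reach_sym Es (cSr _ Gn nSn)) (Bt n) Bu).
Qed.

Lemma splitting_connected W (G : ugraph W) t x y :
  splitting G t -> uvert G x -> uvert G y -> reach (uedge G) (uvert G) x y.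
Proof.
move=> [u [v [S [m [N [[uv SG nSu Sv] [Sr cSr Sm cS]]]]]]] Gx Gy.
have Gu := uedge_vert uv; have Es := @uedge_sym _ G.
suff base z : uvert G z -> reach (uedge G) (uvert G) u z.
  exact: reach_trans (reach_sym Es (base _ Gx)) (base _ Gy).
move=> Gz; have [Sz|nSz] := EM (S z); last first.
  by apply: reach_sub (cSr _ Gz nSz) => ? [].
by apply: reach_step uv (reach_sub SG (Sr _ Sz)).
Qed.

Lemma doubling_blowup W (H : digraph W) (G : ugraph W) :
  digraph_eq H (doubling G) -> blowup H G (fun u => [set u]) (fun u v => u).
Proof.
move=> [HV HE]; split.
- by move=> u v x _ _ -> ->.
- by move=> u Gu x ->; rewrite HV.
- by move=> u x y _ -> ->; exact: reach_refl.
- by move=> u v uv; split=> //; apply/HE.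
Qed.

Lemma path_graph_is_path V (P : ugraph V) n p :
  is_path_graph P n p -> is_path (uedge P) n p.
Proof.
move=> [pI _ pE]; split=> // i lt_in; apply/pE; exists i => //; by left.
Qed.

(** * Subdivided stars and stars of dominated rays *)

Definition star_data W (S : ugraph W) (w : W) (l : nat -> nat)
    (p : nat -> nat -> W) : Prop :=
  [/\ forall n, [/\ 0 < l n, p n 0 = w & is_path (uedge S) (l n) (p n)],
      forall m n i j, i < l m -> j < l n -> p m i.+1 = p n j.+1 -> m = n /\ i = j,
      forall n i, i < l n -> p n i.+1 <> w &
      forall x, uvert S x <-> exists n i, i <= l n /\ x = p n i].

Lemma subdivided_star_data W (S : ugraph W) w T : is_subdivided_star S w T ->
  exists l p, star_data S w l p /\ T = range (fun n => p n (l n)).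
Proof.
move=> [P [l [p [PP PI [SV SE] TE]]]]; exists l, p; split=> //.
have PV n x : uvert (P n) x <-> exists2 i, i <= l n & x = p n i.
  have [_ [_ -> _] _] := PP n; split=> [[i /= il <-]|[i il ->]]; exists i => //.
have pI n i j : i <= l n -> j <= l n -> p n i = p n j -> i = j.
  by have [_ [+ _ _] _] := PP n; apply.
have p0 n : p n 0 = w by case: (PP n).
have pw n i : i < l n -> p n i.+1 <> w.
  by move=> il; rewrite -(p0 n) => /pI; move=> /(_ il (leq0n _)).
split=> //.
- move=> n; have [l0 Pn _] := PP n; split=> //.
  split=> [i il|]; last exact: pI.
  by apply/SE; exists n; apply: (path_graph_is_path Pn).1.
- move=> m n i j im jn e; have [mn|mn] := EM (m = n).
    by subst n; split=> //; have := pI m i.+1 j.+1 im jn e; lia.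
  have /seteqP[/(_ (p m i.+1)) PIw _] := PI _ _ mn.
  case: (pw m i) => //; apply: PIw.
  by split; apply/PV; [exists i.+1 | exists j.+1].
- move=> x; rewrite SV; split=> [[n _ /PV[i il ->]]|[n [i [il ->]]]].
    by exists n, i.
  by exists n => //; apply/PV; exists i.
Qed.

Lemma star_teeth W (S : ugraph W) w l p (t := fun n => p n (l n)) :
  star_data S w l p ->
  [/\ injective t, forall n, t n <> w & forall n, uvert S (t n)].
Proof.
move=> [pP pI pw SV]; split=> [m n|n|n]; rewrite /t.
- have lS q : (l q).-1.+1 = l q by rewrite prednK //; case: (pP q).
  by move=> e; have [] := pI m n (l m).-1 (l n).-1; rewrite ?lS.
- by have [l0 _ _] := pP n; rewrite -(prednK l0); apply: pw; rewrite prednK.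
- by apply/SV; exists n, (l n).
Qed.

(** The split is along the first edge of path [0]: [S] is this path without the centre, and it
    contains only the tooth of index [0]. *)
Lemma star_splitting W (S : ugraph W) w l p :
  star_data S w l p -> splitting S (fun n => p n (l n)).
Proof.
move=> sd; have [tI tw tS] := star_teeth sd; have [pP pI pw SV] := sd.
have pS n i : i <= l n -> uvert S (p n i) by move=> il; apply/SV; exists n, i.
have nS2 n i : n <> 0 -> i <= l n -> ~ [set p 0 k.+1 | k in [set k | k < l 0]] (p n i).
  move=> n0; case: i => [|i] il [k /= kl].
    by have [_ -> _] := pP n; exact: pw.
  by move=> /(pI _ _ _ _ kl il)[] /esym.
have nSw : ~ [set p 0 k.+1 | k in [set k | k < l 0]] w.
  by move=> [k /= kl]; exact: pw.
exists w, (p 0 1), [set p 0 k.+1 | k in [set k | k < l 0]], 0, 1.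
have [l0 p00 pP0] := pP 0; split; split=> //.
- by rewrite -p00; apply: pP0.1.
- by move=> _ [k /= kl <-]; exact: pS.
- by exists 0.
- move=> _ [k /= kl <-]; have := path_reach (i := 1) (j := k.+1) pP0.
  rewrite kl => /(_ isT); apply: reach_sub => _ [[|i] /= ik <-] //.
  by exists i => //=; lia.
- move=> x /SV[n [i [il ->]]] nx.
  have [n0|n0] := EM (n = 0).
    subst n; case: i il nx => [|i] il nx; last by case: nx; exists i.
    by rewrite p00; apply: reach_refl; split=> //; rewrite -p00; exact: pS.
  have [_ pn0 pPn] := pP n; have := path_reach (i := 0) (j := i) pPn.
  rewrite il pn0 => /(_ isT); apply: reach_sub => _ [k /= ki <-].
  by split; [apply: pS; lia | apply: nS2 => //; lia].
- by exists (l 0).-1 => /=; [lia | rewrite prednK].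
- by move=> n n0; split=> //; apply: nS2 => //; lia.
Qed.

Lemma double_star_starlike W (H : digraph W) (S : ugraph W) w l p :
  star_data S w l p -> digraph_eq H (doubling S) ->
  starlike H (fun n => p n (l n)).
Proof.
move=> [pP pI pw SV] [HV HE].
have Es := @uedge_sym _ S.
exists w, (fun n => [set p n k.+1 | k in [set k | k < l n]]); split; last first.
  move=> m n mn _ [i /= il <-] [j /= jl] /(pI _ _ _ _ jl il)[nm _].
  by apply: mn.
move=> n; have [l0 p0 pPn] := pP n.
have e : uedge S w (p n 1) by rewrite -p0; exact: pPn.1.
have r : reach (uedge S) [set p n k.+1 | k in [set k | k < l n]] (p n 1) (p n (l n)).
  have := path_reach (i := 1) (j := l n) pPn.
  rewrite l0 leqnn => /(_ isT); apply: reach_sub => _ [[|i] /= ik <-] //.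
  by exists i => //=; lia.
split.
- by move=> _ [k /= kl <-]; rewrite HV; apply/SV; exists n, k.+1.
- by move=> [k /= kl]; exact: pw.
- exists (p n 1); first exact/HE.
  by apply: reach_mono r => // a b _ _ ab; apply/HE.
- exists (p n 1); first exact/HE/Es.
  by apply: reach_mono (reach_sym Es r) => // a b _ _ ab; apply/HE.
Qed.

Lemma star_of_dominated_ray_blowup W (H : digraph W) T :
  star_of_dominated_ray H T ->
  (exists h, dominated_sequence (dedge H) h) /\
  exists S w l p B att, [/\ star_data S w l p, blowup H S B att,
    T = range (fun n => p n (l n)) & forall x, x <> w -> B x x].
Proof.
move=> [S [w [Q [f [star [domQ fI QV QS] HV HE]]]]].
have QH x y : dedge Q x y -> dedge H x y by move=> q; apply/HE; constructor 1.
have [h seqh Qh] := dominated_ray_sequence domQ.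
split.
  exists h; case: seqh => hI hE; split=> //.
  by case: hE => hE; [left|right] => i; case: (hE i) => /QH + /QH.
have [l [p [sd TE]]] := subdivided_star_data star.
have Sw : uvert S w.
  by have [pP _ _ SV] := sd; apply/SV; exists 0, 0; have [_ ->] := pP 0.
(* The dominated ray is the block of the centre; all other blocks are singletons. *)
pose B u := if pselect (u = w) then dvert Q else [set u].
pose att u v := if pselect (u = w) then f v else u.
have Bw : B w = dvert Q by rewrite /B; case: pselect.
have Bn u : u <> w -> B u = [set u] by rewrite /B; case: pselect.
have attw v : att w v = f v by rewrite /att; case: pselect.
have attn u v : u <> w -> att u v = u by rewrite /att; case: pselect.
have QnS x : dvert Q x -> uvert S x -> x <> w -> False.
  by move=> Qx Sx xw; have /seteqP[/(_ x) + _] := QS; case.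
exists S, w, l, p, B, att; split=> //; last by move=> x /Bn ->.
split.
- move=> u v x Su Sv.
  have [uw|uw] := EM (u = w); have [vw|vw] := EM (v = w).
  + by rewrite uw vw.
  + by rewrite uw Bw (Bn _ vw) => Qx xv; rewrite xv in Qx; case: (QnS v).
  + by rewrite vw Bw (Bn _ uw) => xu Qx; rewrite xu in Qx; case: (QnS u).
  + by rewrite (Bn _ uw) (Bn _ vw) => -> ->.
- move=> u Su x; have [->|uw] := EM (u = w); first by rewrite Bw HV; right.
  by rewrite (Bn _ uw) => ->; rewrite HV; left.
- move=> u x y Su; have [->|uw] := EM (u = w); last first.
    by rewrite (Bn _ uw) => -> ->; exact: reach_refl.
  rewrite Bw Qh => -[i _ <-] [j _ <-].
  by apply: reach_mono (dominated_strong i j seqh) => // a b _ _; exact: QH.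
- move=> u v uv; have [uw|uw] := EM (u = w); have [vw|vw] := EM (v = w).
  + by subst u v; case: (uedge_irr uv).
  + subst u; rewrite Bw attw (attn _ _ vw); split.
      by rewrite QV; exists v.
    by apply/HE; constructor 3; exists v => //; left.
  + subst v; rewrite (Bn _ uw) attw (attn _ _ uw); split=> //.
    by apply/HE; constructor 3; exists u; [exact: uedge_sym | right].
  + rewrite (Bn _ uw) (attn _ _ uw) (attn _ _ vw); split=> //.
    by apply/HE; constructor 2.
Qed.

(** * Combs *)

Definition comb_data W (C : ugraph W) (r : nat -> W) (k l : nat -> nat)
    (p : nat -> nat -> W) : Prop :=
  [/\ [/\ injective r, injective k & forall n, p n 0 = r (k n)],
      [/\ forall n, is_path (uedge C) (l n) (p n),
          forall m n i j, i <= l m -> j <= l n -> p m i = p n j -> m = n &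
          forall n i j, i <= l n -> p n i = r j -> i = 0 /\ j = k n],
      forall x, uvert C x <->
        (exists i, x = r i) \/ (exists n i, i <= l n /\ x = p n i) &
      forall x y, uedge C x y <->
        (exists i, (x = r i /\ y = r i.+1) \/ (x = r i.+1 /\ y = r i)) \/
        (exists n i, i < l n /\
          ((x = p n i /\ y = p n i.+1) \/ (x = p n i.+1 /\ y = p n i)))].

Lemma comb_has_data W (C : ugraph W) T : is_comb C T ->
  exists r k l p, comb_data C r k l p /\ T = range (fun n => p n (l n)).
Proof.
move=> [R [r [P [l [p [[rI RV RE] PP PI [CV CE] TE]]]]]].
have PV n x : uvert (P n) x <-> exists2 i, i <= l n & x = p n i.
  have [[_ -> _] _] := PP n; split=> [[i /= il <-]|[i il ->]]; exists i => //.
have pI n i j : i <= l n -> j <= l n -> p n i = p n j -> i = j.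
  by have [[+ _ _] _] := PP n; apply.
have PR n x : uvert (P n) x -> uvert R x -> x = p n 0.
  by move=> Px Rx; have [_ /seteqP[/(_ x) + _]] := PP n; apply.
have /choice[k kE] n : exists i, p n 0 = r i.
  have [_ /seteqP[_ /(_ (p n 0) erefl)[_]]] := PP n.
  by rewrite RV => -[i _ <-]; exists i.
have PI' m n i j : i <= l m -> j <= l n -> p m i = p n j -> m = n.
  move=> im jn e; have [//|mn] := EM (m = n).
  have /seteqP[/(_ (p m i)) + _] := PI _ _ mn; case.
  by split; apply/PV; [exists i | exists j].
exists r, k, l, p; split=> //; split; split=> //.
- by move=> m n e; apply: (PI' m n 0 0) => //; rewrite !kE e.
- split; last exact: pI.
  move=> i il; apply/CE; right; exists n.
  by have [Pn _] := PP n; apply: (path_graph_is_path Pn).1.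
- move=> n i j il e; have i0 : i = 0.
    apply: (pI n) => //; apply: PR; first by apply/PV; exists i.
    by rewrite RV e; exists j.
  by split=> //; apply: rI; rewrite -e i0 kE.
- rewrite CV => -[|[n _ /PV[i il ->]]]; last by right; exists n, i.
  by rewrite RV => -[i _ <-]; left; exists i.
- rewrite CV => -[[i ->]|[n [i [il ->]]]]; first by left; rewrite RV; exists i.
  by right; exists n => //; apply/PV; exists i.
- move=> /CE[/RE|[n e]]; first by left.
  right; exists n; have [[_ _ /(_ x y)[/(_ e)[i il xy] _]] _] := PP n.
  by exists i.
- move=> [xy|[n [i [il xy]]]]; apply/CE; first by left; apply/RE.
  by right; exists n; have [[_ _ PE] _] := PP n; apply/PE; exists i.
Qed.

Lemma comb_ray_path W (C : ugraph W) r k l p N :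
  comb_data C r k l p -> is_path (uedge C) N r.
Proof.
move=> [[rI _ _] _ _ CE]; split=> [i _|i j _ _ /rI//].
by apply/CE; left; exists i; left.
Qed.

(** The ray is cut just after the vertex carrying path [0]. The attachment indices [k] are injective
    but need not increase; still only finitely many are at most [k 0]. *)
Lemma comb_splitting W (C : ugraph W) r k l p :
  comb_data C r k l p -> splitting C (fun n => p n (l n)).
Proof.
move=> cd; have [[rI kI p0] [pP pI pr] CV CE] := cd.
pose S := [set x | (exists i, i <= k 0 /\ x = r i) \/
                   (exists n i, [/\ i <= l n, k n <= k 0 & x = p n i])].
have Cr i : uvert C (r i) by apply/CV; left; exists i.
have Cp n i : i <= l n -> uvert C (p n i) by move=> il; apply/CV; right; exists n, i.
have Sr i : i <= k 0 -> S (r i) by move=> ik; left; exists i.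
have Sp n i : i <= l n -> k n <= k 0 -> S (p n i) by move=> il nk; right; exists n, i.
have nSr i : k 0 < i -> ~ S (r i).
  move=> ki [[j [jk /rI]]|[n [j [jl nk /esym/(pr _ _ _ jl)[]]]]]; lia.
have nSp n i : i <= l n -> k 0 < k n -> ~ S (p n i).
  move=> il kn [[j [jk /(pr _ _ _ il)[]]]|[m [j [jl mk /(pI _ _ _ _ il jl) mn]]]].
    by lia.
  by rewrite -mn in mk; lia.
have rr i j X : i <= j -> (forall m, i <= m <= j -> X (r m)) ->
    reach (uedge C) X (r i) (r j).
  move=> ij Xr; have := path_reach (i := i) (j := j) (comb_ray_path j cd).
  by rewrite ij leqnn => /(_ isT); apply: reach_sub => _ [m /= mij <-]; exact: Xr.
have pp n i X : i <= l n -> (forall m, m <= i -> X (p n m)) ->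
    reach (uedge C) X (r (k n)) (p n i).
  move=> il Xp; have := path_reach (i := 0) (j := i) (pP n).
  by rewrite il p0 => /(_ isT); apply: reach_sub => _ [m /= mij <-]; exact: Xp.
have [N HN] := injective_unbounded (k 0) kI.
exists (r (k 0).+1), (r (k 0)), S, 0, N; split; split.
- by apply/CE; left; exists (k 0); right.
- by move=> x [[i [_ ->]]|[n [i [il _ ->]]]]; [exact: Cr | exact: Cp].
- exact: nSr.
- exact: Sr.
- have Srr i : i <= k 0 -> reach (uedge C) S (r (k 0)) (r i).
    move=> ik; apply: reach_sym (@uedge_sym _ C) _; apply: rr => // m mi.
    by apply: Sr; lia.
  move=> _ [[i [ik ->]]|[n [i [il nk ->]]]]; first exact: Srr.
  by apply: reach_trans (Srr _ nk) _; apply: pp => // m mi; apply: Sp => //; lia.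
- have Trr i : k 0 < i -> reach (uedge C) (uvert C `\` S) (r (k 0).+1) (r i).
    by move=> ki; apply: rr => // m mi; split; [exact: Cr | apply: nSr; lia].
  move=> x /CV[[i ->]|[n [i [il ->]]]] nSx.
    by apply: Trr; rewrite ltnNge; apply/negP => /Sr.
  have kn : k 0 < k n by rewrite ltnNge; apply/negP => /(Sp _ _ il).
  apply: reach_trans (Trr _ kn) _; apply: pp => // m mi.
  by split; [apply: Cp; lia | apply: nSp => //; lia].
- exact: Sp.
- by move=> n Nn; split; [exact: Cp | apply: nSp => //; exact: HN].
Qed.

Lemma comb_teeth_inj W (C : ugraph W) r k l p :
  comb_data C r k l p -> injective (fun n => p n (l n)).
Proof. by move=> [_ [_ pI _] _ _] m n; exact: pI. Qed.

Lemma double_comb_triples W (H : digraph W) (C : ugraph W) r k l p :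
  comb_data C r k l p -> digraph_eq H (doubling C) -> two_strong_triples H.
Proof.
move=> cd [HV HE]; have [[rI _ _] _ CV CE] := cd.
(* Three consecutive vertices of the ray; starting at [0] and at [3] makes two such segments
   disjoint. *)
pose A i := [set r m | m in [set m | i <= m <= i.+2]].
have sA i : strong_triple H (A i) (r i) (r i.+1) (r i.+2).
  have rr m n : i <= m <= n -> n <= i.+2 -> reach (uedge C) (A i) (r m) (r n).
    move=> /andP[im mn] ni.
    have := path_reach (i := m) (j := n) (comb_ray_path n cd).
    rewrite mn leqnn => /(_ isT); apply: reach_sub => _ [j /= mj <-].
    by exists j => //=; lia.
  have HC x y : reach (uedge C) (A i) x y -> reach (dedge H) (A i) x y.
    by apply: reach_mono => // a b _ _ ab; apply/HE.
  split.
  - by move=> _ [m _ <-]; rewrite HV; apply/CV; left; exists m.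
  - by split=> /rI; lia.
  - split; apply: HC; try (apply: rr; lia).
    by apply: reach_sym (@uedge_sym _ C) _; apply: rr; lia.
exists (A 0), (A 3), (r 0), (r 1), (r 2), (r 3), (r 4), (r 5); split; try exact: sA.
by move=> _ [m /= m2 <-] [n /= n5 /rI]; lia.
Qed.

Lemma has_degree_le V (G : ugraph V) x d n (f : nat -> V) :
  has_degree G x d -> (forall y, uedge G x y -> exists2 i, i < n & y = f i) ->
  d <= n.
Proof.
move=> deg nb; rewrite -card_le_II.
apply: (@card_le_trans _ _ _ [set y | uedge G x y]); first by have /card_eqPle[] := deg.
apply: (@card_le_trans _ _ _ (f @` `I_n)); last exact: card_image_le.
by apply: subset_card_le => y /nb[i il ->]; exists i.
Qed.

Lemma has_degree_enum V (G : ugraph V) x n (f : nat -> V) :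
  (forall i j, i < n -> j < n -> f i = f j -> i = j) ->
  (forall y, uedge G x y <-> exists2 i, i < n & y = f i) ->
  has_degree G x n.
Proof.
move=> fI nb; rewrite /has_degree.
have -> : [set y | uedge G x y] = f @` `I_n.
  by apply/seteqP; split=> [y /nb[i il ->]|_ [i il <-]]; [exists i | apply/nb; exists i].
by apply: inj_card_eq => i j; rewrite !inE; exact: fI.
Qed.

Lemma comb_tooth_degree W (C : ugraph W) r k l p n :
  comb_data C r k l p -> ~ has_degree C (p n (l n)) 3.
Proof.
move=> [[rI kI p0] [pP pI pr] CV CE].
(* The tooth has its predecessor on a nontrivial path as only neighbour, and otherwise only
   neighbours on the ray. For [k n = 0] the value [r (k n).-1] is the tooth itself, which is
   harmless in an upper bound. *)
pose f i := if l n is m.+1 then p n m else if i is 0 then r (k n).-1 else r (k n).+1.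
move=> /(has_degree_le (n := 2) (f := f)); suff /[swap]/[apply] :
    forall y, uedge C (p n (l n)) y -> exists2 i, i < 2 & y = f i by [].
move=> y /CE[[i]|[m [i [il]]]].
  case=> -[/(pr _ _ _ (leqnn _))[ln kn] ->]; rewrite /f ln; [exists 1|exists 0] => //.
    by rewrite kn.
  by rewrite -kn.
have same j : j <= l m -> p n (l n) = p m j -> m = n /\ j = l n.
  move=> jl e; have mn := pI _ _ _ _ (leqnn _) jl e; subst m; split=> //.
  exact/esym/(pP n).2.
case=> -[e ->]; have [|mn] := same _ _ e; try lia.
  by subst m; lia.
by move=> ln; exists 0 => //; rewrite /f -ln mn.
Qed.

(** A trivial path makes [r (k n)] a tooth of degree 2, a nontrivial one makes its degree 3. The
    first vertex of the ray has one neighbour less, hence the condition [0 < k n]. *)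
Lemma comb_junction W (C : ugraph W) r k l p n :
  comb_data C r k l p -> 0 < k n ->
  junction C (range (fun n => p n (l n))) (r (k n)).
Proof.
move=> [[rI kI p0] [pP pI pr] CV CE] kn.
split; first by apply/CV; left; exists (k n).
have nb y : uedge C (r (k n)) y <->
    [\/ y = r (k n).-1, y = r (k n).+1 | 0 < l n /\ y = p n 1].
  split=> [/CE[[i]|[m [i [il]]]]|].
  - by case=> -[/rI-> ->]; [constructor 2 | constructor 1].
  - case=> -[/esym]; last by move=> /(pr _ _ _ il)[].
    by move=> /(pr _ _ _ (ltnW il))[i0 /kI mn] ->; subst i m; constructor 3.
  - case=> [->|->|[ln ->]]; apply/CE.
    + by left; exists (k n).-1; right; rewrite prednK.
    + by left; exists (k n); left.
    + by right; exists n, 0; split=> //; left; rewrite p0.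
have [l0|lpos] := posnP (l n).
  right; split; first by exists n => //; rewrite l0 p0.
  apply: (has_degree_enum (f := fun i => if i is 0 then r (k n).-1 else r (k n).+1)).
    by move=> [|[|i]] [|[|j]] // _ _ /rI; lia.
  move=> y; split=> [/nb[->|->|[]]|[[|[|i]] // _ ->]].
  - by exists 0.
  - by exists 1.
  - by rewrite l0.
  - by apply/nb; constructor 1.
  - by apply/nb; constructor 2.
left; apply: (has_degree_enum
    (f := fun i => match i with 0 => r (k n).-1 | 1 => r (k n).+1 | _ => p n 1 end)).
  have pnr j : p n 1 <> r j by move=> /(pr _ _ _ lpos)[].
  move=> [|[|[|i]]] [|[|[|j]]] // _ _; first [by move=> /rI; lia | by move=> /pnr |
    by move=> /esym/pnr].
move=> y; split=> [/nb[->|->|[_ ->]]|[[|[|[|i]]] // _ ->]].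
- by exists 0.
- by exists 1.
- by exists 2.
- by apply/nb; constructor 1.
- by apply/nb; constructor 2.
- by apply/nb; constructor 3.
Qed.

(** * Combs and chains of triangles *)

Lemma triangle_reach W (H : digraph W) (K : digraph W) :
  is_directed_triangle K -> (forall x y, dedge K x y -> dedge H x y) ->
  exists x y z, [/\ [/\ x <> y, y <> z & z <> x], dvert K = [set x; y; z],
    [/\ dedge H x y, dedge H y z & dedge H z x] &
    [/\ reach (dedge H) (dvert K) x y, reach (dedge H) (dvert K) y z &
        reach (dedge H) (dvert K) z x]].
Proof.
move=> [x [y [z [ne KV KE]]]] KH; exists x, y, z; split=> //.
  by split; apply/KH/KE; [constructor 1|constructor 2|constructor 3].
have Kx : dvert K x by rewrite KV; left; left.
have Ky : dvert K y by rewrite KV; left; right.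
have Kz : dvert K z by rewrite KV; right.
by split; apply: reach_edge => //; apply/KH/KE; [constructor 1|constructor 2|constructor 3].
Qed.

Lemma comb_of_triangles_facts W (H : digraph W) T :
  comb_of_triangles H T ->
  [/\ directed_3cycle H, two_strong_triples H &
      exists C r k l p B att, [/\ comb_data C r k l p, blowup H C B att,
        T = range (fun n => p n (l n)) & forall n, B (p n (l n)) (p n (l n))]].
Proof.
move=> [C [K [att [comb [KT KC KK] [attn attJ _ KJ] HV HE]]]].
have [r [k [l [p [cd TE]]]]] := comb_has_data comb.
set J := junction C T in KT KC KK attn attJ KJ HV HE.
have KH j x y : J j -> dedge (K j) x y -> dedge H x y.
  by move=> Jj xy; apply/HE; left; exists j.
have KHV j : J j -> dvert (K j) `<=` dvert H.
  by move=> Jj x Kx; rewrite HV; right; exists j.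
have [[rI kI p0] _ _ _] := cd.
have Jr n : 0 < k n -> J (r (k n)) by rewrite /J TE; exact: comb_junction.
(* Beyond [N] no path starts at the first vertex of the ray, so two consecutive indices give two
   junctions with disjoint triangles. *)
have [N HN] := injective_unbounded 0 kI.
have kN := HN _ (leqnn N); have kN1 := HN _ (leqnSn N).
have ne : r (k N) <> r (k N.+1) by move=> /rI/kI; lia.
have [x [y [z [xyz KV [xy yz zx] [rxy ryz rzx]]]]] :=
  triangle_reach (KT _ (Jr _ kN)) (fun x y => KH _ x y (Jr _ kN)).
have [x' [y' [z' [xyz' _ _ [rxy' ryz' rzx']]]]] :=
  triangle_reach (KT _ (Jr _ kN1)) (fun x y => KH _ x y (Jr _ kN1)).
split.
- by exists x, y, z.
- exists (dvert (K (r (k N)))), (dvert (K (r (k N.+1)))), x, y, z, x', y', z'.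
  split; [split=> //; exact/KHV/Jr.. |].
  by move=> a Ka Ka'; have /seteqP[/(_ a) + _] := KK _ _ (Jr _ kN) (Jr _ kN1) ne; apply.
pose B u := if pselect (J u) then dvert (K u) else [set u].
have BJ u : J u -> B u = dvert (K u) by rewrite /B; case: pselect.
have Bn u : ~ J u -> B u = [set u] by rewrite /B; case: pselect.
have KnC j u : J j -> uvert C u -> ~ J u -> dvert (K j) u -> False.
  by move=> Jj Cu nJu Ku; have /seteqP[/(_ u) + _] := KC _ Jj; apply.
exists C, r, k, l, p, B, att; split=> //; last first.
  (* A tooth never has degree 3, so if it is a junction its triangle contains the tooth itself. *)
  move=> n; have [Jt|nJt] := EM (J (p n (l n))); last by rewrite Bn.
  by rewrite BJ //; case: (KJ _ Jt (comb_tooth_degree cd)).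
split.
- move=> u v a Cu Cv.
  have [Ju|nJu] := EM (J u); have [Jv|nJv] := EM (J v).
  + rewrite !BJ // => Ku Kv; have [//|uv] := EM (u = v).
    by have /seteqP[/(_ a) + _] := KK _ _ Ju Jv uv; case.
  + by rewrite BJ // Bn // => Ku av; rewrite av in Ku; case: (KnC u v).
  + by rewrite Bn // BJ // => au Kv; rewrite au in Kv; case: (KnC v u).
  + by rewrite !Bn // => -> ->.
- move=> u Cu; have [Ju|nJu] := EM (J u); first by rewrite BJ //; exact: KHV.
  by rewrite Bn // => _ ->; rewrite HV; left.
- move=> u a b Cu; have [Ju|nJu] := EM (J u); last first.
    by rewrite Bn // => -> ->; exact: reach_refl.
  rewrite BJ //; have [c [d [e [_ KuV _ [rcd rde rec]]]]] :=
    triangle_reach (KT _ Ju) (fun x y => KH _ x y Ju).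
  have base q : dvert (K u) q -> reach (dedge H) (dvert (K u)) c q /\
      reach (dedge H) (dvert (K u)) q c.
    rewrite [in X in X -> _]KuV => -[[->|->]|->]; split=> //.
    + exact/reach_refl/(reach_source rcd).
    + exact/reach_refl/(reach_source rcd).
    + exact: reach_trans rde rec.
    + exact: reach_trans rcd rde.
  by move=> /base[_ ac] /base[cb _]; exact: reach_trans ac cb.
- move=> u v uv; split.
    have [Ju|nJu] := EM (J u); first by rewrite BJ //; exact: attJ.
    by rewrite Bn // attn.
  by apply/HE; right; exists u, v.
Qed.

Lemma chain_of_triangles_facts W (H : digraph W) T :
  chain_of_triangles H T ->
  [/\ directed_3cycle H, two_strong_triples H & two_ended H].
Proof.
move=> [a [b [c [P [l [p [[[aI bI cI] abc] _ HV HE _]]]]]]].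
have ab i : dedge H (a i) (b i) by apply/HE; exists i; left; constructor 1.
have bc i : dedge H (b i) (c i) by apply/HE; exists i; left; constructor 2.
have ca i : dedge H (c i) (a i) by apply/HE; exists i; left; constructor 3.
have aa i : dedge H (a i.+1) (a i) by apply/HE; exists i; right; constructor 1.
have cc i : dedge H (c i) (c i.+1) by apply/HE; exists i; right; constructor 2.
have ne i : [/\ a i <> b i, b i <> c i & c i <> a i] by exact: abc.
pose A i := [set a i; b i; c i].
have Aa i : A i (a i) by left; left.
have Ab i : A i (b i) by left; right.
have Ac i : A i (c i) by right.
have sA i : strong_triple H (A i) (a i) (b i) (c i).
  split=> //; last by split; apply: reach_edge.
  move=> x [[->|->]|->]; [by case: (dedge_vert (ab i)) | by case: (dedge_vert (bc i))|].
  by case: (dedge_vert (ca i)).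
split.
- by exists (a 0), (b 0), (c 0).
- exists (A 0), (A 1), (a 0), (b 0), (c 0), (a 1), (b 1), (c 1); split=> // x.
  have [[ab01 bc01 ca01] [ab10 bc10 ca10]] := (abc 0 1, abc 1 0).
  case=> [[->|->]|->] [[]|] e; first [by move: (aI _ _ e) | by move: (bI _ _ e) |
    by move: (cI _ _ e) | exact: ab01 | exact: ca10 (esym e) | exact: ab10 (esym e) |
    exact: bc01 | exact: ca01 | exact: bc10 (esym e)].
(* The rays [a] and [c] are disjoint, so [h] misses one of them: [c] leads from [c 0] to infinity,
   and [a] leads from infinity to [a 0]. *)
exists (a 0), (c 0) => h.
have [[i hi]|no] := EM (exists i, h = a i).
  exists (c 0), c, 0; split; [by right | by [] | |].
    by move=> n; case: (dedge_vert (ca n)).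
  have Xc n : (dvert H `\ h) (c n).
    split; first by case: (dedge_vert (ca n)).
    by rewrite hi => /= e; have [_ _ /(_ e)] := abc n i.
  move=> n _; left; elim: n => [|n IH]; first exact: reach_refl.
  by apply: reach_trans IH _; exact: reach_edge.
exists (a 0), a, 0; split; [by left | by [] | |].
  by move=> n; case: (dedge_vert (ab n)).
have Xa n : (dvert H `\ h) (a n).
  split; first by case: (dedge_vert (ab n)).
  by move=> /= e; apply: no; exists n.
move=> n _; right; elim: n => [|n IH]; first exact: reach_refl.
by apply: reach_trans IH; exact: reach_edge.
Qed.

(** * The invariants of each type, and the conclusion *)

Definition separated_teeth W (H : digraph W) (T : set W) : Prop :=
  exists t, [/\ T = range t, separating H t, injective t & forall n, dvert H (t n)].

Lemma dominated_directed_ray_facts W (H : digraph W) T :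
  dominated_directed_ray H T ->
  T = dvert H /\ exists h, dominated_sequence (dedge H) h.
Proof. by move=> [/dominated_ray_sequence[h seqh _] ->]; split=> //; exists h. Qed.

Lemma doubling_connected W (H : digraph W) (G : ugraph W) t :
  digraph_eq H (doubling G) -> splitting G t ->
  (forall x y, dedge H x y -> dedge H y x) /\ strongly_connected H.
Proof.
move=> [HV HE] spl; split=> [x y /HE xy|x y]; first by apply/HE/uedge_sym.
rewrite HV => Gx Gy; apply: (@reach_reachable _ _ (uvert G)).
by apply: reach_mono (splitting_connected spl Gx Gy) => // a b _ _ ab; apply/HE.
Qed.

Lemma double_star_facts W (H : digraph W) T : double_star H T ->
  [/\ separated_teeth H T, exists2 t, T = range t & starlike H t,
      forall x y, dedge H x y -> dedge H y x & strongly_connected H].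
Proof.
move=> [S [w [star HS]]]; have [l [p [sd TE]]] := subdivided_star_data star.
have [tI tw tS] := star_teeth sd; have spl := star_splitting sd.
have [Hs Hc] := doubling_connected HS spl; split=> //.
  exists (fun n => p n (l n)); split=> //; last by move=> n; rewrite HS.1; exact: tS.
  exact: blowup_separating (doubling_blowup HS) spl tI _.
by exists (fun n => p n (l n)); last exact: double_star_starlike sd HS.
Qed.

Lemma star_of_dominated_ray_facts W (H : digraph W) T :
  star_of_dominated_ray H T ->
  separated_teeth H T /\ exists h, dominated_sequence (dedge H) h.
Proof.
move=> /star_of_dominated_ray_blowup[seqh [S [w [l [p [B [att [sd blow TE Bx]]]]]]]].
split=> //; have [tI tw tS] := star_teeth sd; have [_ BH _ _] := blow.
have Bt n : B (p n (l n)) (p n (l n)) by exact: Bx.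
exists (fun n => p n (l n)); split=> //; last by move=> n; exact: BH (tS n) _ (Bt n).
exact: blowup_separating blow (star_splitting sd) tI Bt.
Qed.

Lemma comb_teeth_separated W (H : digraph W) (C : ugraph W) r k l p B att :
  comb_data C r k l p -> blowup H C B att -> (forall n, B (p n (l n)) (p n (l n))) ->
  separated_teeth H (range (fun n => p n (l n))).
Proof.
move=> cd blow Bt; have [_ BH _ _] := blow; have tI := comb_teeth_inj cd.
have Ct n : uvert C (p n (l n)) by case: cd => _ _ CV _; apply/CV; right; exists n, (l n).
exists (fun n => p n (l n)); split=> //; last by move=> n; exact: BH (Ct n) _ (Bt n).
exact: blowup_separating blow (comb_splitting cd) tI Bt.
Qed.

Lemma double_comb_facts W (H : digraph W) T : double_comb H T ->
  [/\ separated_teeth H T, two_strong_triples H,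
      forall x y, dedge H x y -> dedge H y x & strongly_connected H].
Proof.
move=> [C [comb HC]]; have [r [k [l [p [cd ->]]]]] := comb_has_data comb.
have [Hs Hc] := doubling_connected HC (comb_splitting cd); split=> //.
  exact: comb_teeth_separated cd (doubling_blowup HC) _.
exact: double_comb_triples cd HC.
Qed.

Lemma comb_of_triangles_separated W (H : digraph W) T :
  comb_of_triangles H T -> separated_teeth H T.
Proof.
move=> /comb_of_triangles_facts[_ _ [C [r [k [l [p [B [att [cd blow -> Bt]]]]]]]]].
exact: comb_teeth_separated cd blow Bt.
Qed.

Lemma infinite_range V (f : nat -> V) : injective f -> infinite_set (range f).
Proof.
move=> fI; apply/infiniteP.
have /card_eqPle[] // : (range f #= [set: nat])%card by apply: inj_card_eq => ? ? _ _ /fI.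
Qed.

Theorem proposition6p1 :
  forall tau : digraph_type,
  exists (V : Type) (D : digraph V) (U : set V),
    [/\ strongly_connected D,
        U `<=` dvert D,
        infinite_set U &
        forall sigma : digraph_type, sigma <> tau ->
        forall (W : Type) (H : digraph W) (T : set W),
          is_of_type sigma H T ->
          forall M : tree_like_model H D,
            ~ (forall t, T t -> U (model_root M t))].
Proof.
case.
- exists nat, cone, setT; split; [exact: cone_strong | by [] | exact: infinite_nat |].
  move=> sigma ne W H T HT M _; apply: (cone_excludes M).
  case: sigma ne HT => // _.
  + by move=> /double_star_facts[[t [_ st _ _]] _ _ _]; exact: separating_incomparable st.
  + by move=> /star_of_dominated_ray_facts[[t [_ st _ _]] _]; exact: separating_incomparable st.
  + by move=> /double_comb_facts[_ st _ _]; exact: two_strong_triples_incomparable.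
  + by move=> /comb_of_triangles_facts[_ st _]; exact: two_strong_triples_incomparable.
  + by move=> /chain_of_triangles_facts[_ st _]; exact: two_strong_triples_incomparable.
- exists nat, hub, setT; split; [exact: hub_strong | by [] | exact: infinite_nat |].
  move=> sigma ne W H T HT M _; apply: (hub_excludes M).
  case: sigma ne HT => // _.
  + by move=> /dominated_directed_ray_facts[_ [h]]; exact: dominated_disjoint_edges.
  + by move=> /star_of_dominated_ray_facts[_ [h]]; exact: dominated_disjoint_edges.
  + by move=> /double_comb_facts[_ st _ _]; exact: two_strong_triples_edges.
  + by move=> /comb_of_triangles_facts[_ st _]; exact: two_strong_triples_edges.
  + by move=> /chain_of_triangles_facts[_ st _]; exact: two_strong_triples_edges.
- exists (nat * bool)%type, broom, (range (fun i => (i, true))).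
  split; [exact: broom_strong | by [] | by apply: infinite_range => i j [] |].
  move=> sigma ne W H T HT M TU.
  case: sigma ne HT => // _.
  + move=> /dominated_directed_ray_facts[TE [h /dominated_path]].
    move=> [x [y [z [u [[xy yz _] [[nxy nyz _] nxz _ _]]]]]].
    apply: (broom_excludes_path (M := M) xy yz nxy nyz nxz) => v vE.
    have [|i _ <-] := TU v; last by exists i.
    rewrite TE; case: vE => [->|[->|->]]; [by case: (dedge_vert xy) | |];
      by case: (dedge_vert yz).
  + move=> /double_star_facts[_ [t TE st] _ _].
    apply: (broom_excludes_star (M := M) st) => n.
    by have [|i _ <-] := TU (t n); [rewrite TE; exists n | exists i].
  + by move=> /double_comb_facts[_ st _ _]; exact: broom_excludes_triples M st.
  + by move=> /comb_of_triangles_facts[_ st _]; exact: broom_excludes_triples M st.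
  + by move=> /chain_of_triangles_facts[_ st _]; exact: broom_excludes_triples M st.
- exists nat, line, setT; split; [exact: line_strong | by [] | exact: infinite_nat |].
  move=> sigma ne W H T HT M _.
  case: sigma ne HT => // _.
  + move=> /dominated_directed_ray_facts[_ [h /dominated_3cycle]].
    exact: line_excludes_3cycle M.
  + by move=> /double_star_facts[_ [t _ st] _ _]; exact: line_excludes_star M _ st.
  + move=> /star_of_dominated_ray_facts[_ [h /dominated_3cycle]].
    exact: line_excludes_3cycle M.
  + by move=> /comb_of_triangles_facts[c _ _]; exact: line_excludes_3cycle M c.
  + by move=> /chain_of_triangles_facts[c _ _]; exact: line_excludes_3cycle M c.
- exists (nat * bool)%type, strip, (range (fun i => (i, true))).
  split; [exact: strip_strong | by [] | by apply: infinite_range => i j [] |].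
  move=> sigma ne W H T HT M TU.
  have tip t n : T = range t -> exists i, model_root M (t n) = (i, true).
    by move=> TE; have [|i _ <-] := TU (t n); [rewrite TE; exists n | exists i].
  case: sigma ne HT => // _.
  + move=> /dominated_directed_ray_facts[_ [h /dominated_two_ended]].
    exact: strip_excludes_two_ended M.
  + move=> /double_star_facts[[t [TE _ tI tH]] _ Hs Hc].
    by apply: (strip_excludes_double (M := M) Hs Hc tI tH) => n; exact: tip.
  + move=> /star_of_dominated_ray_facts[_ [h /dominated_two_ended]].
    exact: strip_excludes_two_ended M.
  + move=> /double_comb_facts[[t [TE _ tI tH]] _ Hs Hc].
    by apply: (strip_excludes_double (M := M) Hs Hc tI tH) => n; exact: tip.
  + by move=> /chain_of_triangles_facts[_ _ c]; exact: strip_excludes_two_ended M c.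
- exists (nat * corner)%type, ladder, (range (fun i => (i, CornerB))).
  split; [exact: ladder_strong | by [] | by apply: infinite_range => i j [] |].
  move=> sigma ne W H T HT M TU.
  (* This one obstruction disposes of types (ii) to (v), leaving only the dominated rays. *)
  have nsep : ~ separated_teeth H T.
    move=> [t [TE st tI tH]]; apply: (ladder_excludes_separating (M := M) st tI tH) => n.
    by have [|i _ <-] := TU (t n); [rewrite TE; exists n | exists i].
  case: sigma ne HT => // _.
  + move=> /dominated_directed_ray_facts[TE [h /dominated_path]].
    move=> [x [y [z [u [[xy yz zu] [nxyzu nxz nyu _]]]]]].
    apply: (ladder_excludes_path (M := M) xy yz zu nxyzu nxz nyu) => v Hv.
    by have [|i _ <-] := TU v; [rewrite TE | exists i].
  + by move=> /double_star_facts[].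
  + by move=> /star_of_dominated_ray_facts[].
  + by move=> /double_comb_facts[].
  + by move=> /comb_of_triangles_separated.
Qed.
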